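(* Let $(V,\omega)$ be a vertex operator algebra with an automorphism $g$ of finite order $T$, and let $n\in(1/T)\mathbb{N}$. Then the associative algebra $\tilde{A}_{g,n}(V,\omega)$ is isomorphic to the associative algebra $A_{g,n}(V,\omega)$.
   Context: All vector spaces are over $\mathbb{C}$, and $\mathbb{N}=\{0,1,2,\dots\}$. A vertex algebra is a vector space $V$ with a linear map $Y(\cdot,x):V\to(\operatorname{End}V)[[x,x^{-1}]]$, $v\mapsto Y(v,x)=\sum_{n\in\mathbb{Z}}v_nx^{-n-1}$, and a vector $\mathbf{1}\in V$ such that for all $u,v\in V$: $Y(\mathbf{1},z)=\operatorname{id}_V$ and $u_n\mathbf{1}=\delta_{n,-1}u$ for $n\ge -1$; $u_nv=0$ for $n$ sufficiently large; and the Jacobi identity $$z_0^{-1}\delta\left(\tfrac{z_1-z_2}{z_0}\right)Y(u,z_1)Y(v,z_2)-z_0^{-1}\delta\left(\tfrac{z_2-z_1}{-z_0}\right)Y(v,z_2)Y(u,z_1)=z_2^{-1}\delta\left(\tfrac{z_1-z_0}{z_2}\right)Y(Y(u,z_0)v,z_2)$$ holds, where $\delta(z)=\sum_{k\in\mathbb{Z}}z^k$ and binomials are expanded in nonnegative powers of the second variable. Put $\mathcal{D}v=v_{-2}\mathbf{1}$. A conformal vector of $V$ is $\omega\in V$ such that, with $L(n)=\omega_{n+1}$: $[L(m),L(n)]=(m-n)L(m+n)+\frac{m^3-m}{12}\delta_{m+n,0}c_V$ for some $c_V\in\mathbb{C}$ (central charge); $L(-1)=\mathcal{D}$; $L(0)$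 is semisimple, $V=\bigoplus_{n\in\mathbb{C}}V_n$ with $L(0)|_{V_n}=n\operatorname{id}$ (eigenvalues are called conformal weights); and each $L(n)$, $n\ge1$, acts locally nilpotently. A conformal vertex algebra $(V,\omega)$ is a vertex algebra with a conformal vector. A vertex operator algebra is a conformal vertex algebra with integer conformal weights, $\dim V_n<\infty$ for all $n\in\mathbb{Z}$, and $V_n=0$ for $n$ sufficiently small. For homogeneous $u\in V_n$, $\operatorname{wt}u=n$. An automorphism of $(V,\omega)$ is a linear isomorphism $g$ with $g(\mathbf{1})=\mathbf{1}$, $g(Y(u,z)v)=Y(g(u),z)g(v)$ and $g(\omega)=\omega$. For $g$ of finite order $T$, $V=\bigoplus_{r=0}^{T-1}V^r$ with $V^r=\{v\in V\mid gv=e^{-2\pi\sqrt{-1}r/T}v\}$; always $r\in\{0,\dots,T-1\}$. For $k,l\in\{0,\dots,T-1\}$ put $\delta_k(l)=1$ if $k\ge l$, $0$ if $k<l$; put $\delta_k(T)=0$. For $n\in(1/T)\mathbb{N}$ write $n=\lfloor n\rfloor+\bar n/T$ with $\bar n\in\{0,\dots,T-1\}$. $\operatorname{Res}_x$ is the coefficient of $x^{-1}$ of the Laurent expansion in $x$. The algebra $A_{g,n}(V,\omega)$ (Dong–Li–Mason): for homogeneous $u\in V^r$ and $v\in V$ define (extending linearly) $$u\circ_{g,n}v=\operatorname{Res}_z\frac{(1+z)^{\operatorname{wt}u-1+\delta_{\bar n}(r)+\lfloor n\rfloor+r/T}}{z^{2\lfloor n\rfloor+\delta_{\bar n}(r)+\delta_{\bar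 n}(T-r)+1}}Y(u,z)v,$$ $$u*_{g,n}v=\sum_{m=0}^{\lfloor n\rfloor}(-1)^m\binom{m+\lfloor n\rfloor}{\lfloor n\rfloor}\operatorname{Res}_z\frac{(1+z)^{\operatorname{wt}u+\lfloor n\rfloor}}{z^{\lfloor n\rfloor+m+1}}Y(u,z)v\ \text{ if }r=0,$$ and $u*_{g,n}v=0$ if $r>0$. $O_{g,n}(V)$ is the span of all $u\circ_{g,n}v$ and $L(-1)u+L(0)u$, and $A_{g,n}(V,\omega)=V/O_{g,n}(V)$ with product induced by $*_{g,n}$; it is known to be an associative algebra with identity $\mathbf{1}+O_{g,n}(V)$. The algebra $\tilde{A}_{g,n}(V,\omega)=\tilde A_{g,n}(V)$ depends only on the vertex algebra $V$ and $g$: for $u\in V^r$, $v\in V$ define (extending linearly in $u$) $$u\diamond_{g,n}v=\operatorname{Res}_x\frac{e^{x(\delta_{\bar n}(r)+\lfloor n\rfloor+r/T)}}{(e^x-1)^{2\lfloor n\rfloor+\delta_{\bar n}(r)+\delta_{\bar n}(T-r)+1}}Y(u,x)v,$$ $$u\bullet_{g,n}v=\sum_{m=0}^{\lfloor n\rfloor}(-1)^m\binom{m+\lfloor n\rfloor}{\lfloor n\rfloor}\operatorname{Res}_x\frac{e^{x(\lfloor n\rfloor+1)}}{(e^x-1)^{\lfloor n\rfloor+m+1}}Y(u,x)v\ \text{ if }r=0,$$ and $u\bullet_{g,n}v=0$ if $r>0$. $\tilde{O}_{g,n}(V)$ is the span of all $u\diamond_{g,n}v$ and $\mathcal{D}u$,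 and $\tilde{A}_{g,n}(V)=V/\tilde{O}_{g,n}(V)$ with product induced by $\bullet_{g,n}$, an associative algebra with identity $\mathbf{1}+\tilde O_{g,n}(V)$. *)

(* Defs.v *)
From HB Require Import structures.
From mathcomp Require Import all_boot all_order all_algebra.
From mathcomp Require Import ring_quotient generic_quotient.
From mathcomp Require Import complex.
From mathcomp Require Import boolp classical_sets functions cardinality fsbigop.
From mathcomp Require Import reals trigo.

Set Implicit Arguments.
Unset Strict Implicit.
Unset Printing Implicit Defensive.
Import Order.TTheory GRing.Theory Num.Theory.

Local Open Scope classical_set_scope.
Local Open Scope ring_scope.

(* Conventions. The complex numbers are R[i] for R : realType. Infinite sums
   are the finitely supported sums \sum_(i \in A) F i of fsbigop; every such
   sum below has finite support as soon as the hypotheses of the notion at hand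
   hold. *)

Section LinearAlgebra.
Variables (K : fieldType) (V : lmodType K).
Implicit Types (S : set V).

Definition subspace_closed S : Prop :=
  S 0 /\ forall (a : K) (u v : V), S u -> S v -> S (a *: u + v).

Definition lspan S : set V := smallest subspace_closed S.

Lemma lspan_closed S : subspace_closed (lspan S).
Proof.
split=> [M [[M0 _] _] //|a u v Su Sv M MS].
by case: (MS) => -[_ MZ] _; apply: MZ; [apply: Su|apply: Sv].
Qed.

Definition lspan_pred S : {pred V} := fun v => `[< lspan S v >].

Lemma lspan_zmod_closed S : zmod_closed (lspan_pred S).
Proof.
have [S0 SZ] := lspan_closed S; split=> [|u v]; rewrite !unfold_in.
  exact/asboolP.
move=> /asboolP Su /asboolP Sv; apply/asboolP.
by rewrite addrC -scaleN1r; exact: SZ.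
Qed.

HB.instance Definition _ S :=
  GRing.isZmodClosed.Build V (lspan_pred S) (lspan_zmod_closed S).

Definition quotient_space S := Quotient.quot (lspan_pred S : zmodClosed V).

HB.instance Definition _ S := GRing.Zmodule.on (quotient_space S).

Definition quotient_map S (v : V) : quotient_space S :=
  \pi_(quotient_space S)%qT v.

Lemma quotient_map_eq S (u v : V) :
  quotient_map S u = quotient_map S v <-> lspan S (u - v).
Proof.
rewrite /quotient_map; split.
  by move=> /eqP; rewrite -Quotient.idealrBE => /asboolP.
by move=> /asboolP h; apply/eqP; rewrite -Quotient.idealrBE.
Qed.

Lemma quotient_map_surj S (a : quotient_space S) :
  exists v, quotient_map S v = a.
Proof. by exists (repr a); exact: reprK. Qed.

Lemma quotient_mapD S : {morph quotient_map S : u v / u + v}.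
Proof. by move=> u v; rewrite /quotient_map !piE. Qed.

Definition quotient_scale S (c : K) (a : quotient_space S) : quotient_space S :=
  quotient_map S (c *: repr a).

Lemma quotient_mapZ S (c : K) (v : V) :
  quotient_map S (c *: v) = quotient_scale c (quotient_map S v).
Proof.
apply/quotient_map_eq; have [S0 SZ] := lspan_closed S.
rewrite -scalerBr -[_ *: _]addr0; apply: SZ => //.
by apply/quotient_map_eq; rewrite /quotient_map reprK.
Qed.

Fact quotient_scaleA S (c d : K) (a : quotient_space S) :
  quotient_scale c (quotient_scale d a) = quotient_scale (c * d) a.
Proof.
by have [v <-] := quotient_map_surj a; rewrite -!quotient_mapZ scalerA.
Qed.

Fact quotient_scale1 S : left_id 1 (@quotient_scale S).
Proof.
by move=> a; have [v <-] := quotient_map_surj a; rewrite -quotient_mapZ scale1r.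
Qed.

Fact quotient_scaleDr S : right_distributive (@quotient_scale S) +%R.
Proof.
move=> c a b; have [u <-] := quotient_map_surj a.
have [v <-] := quotient_map_surj b.
by rewrite -quotient_mapD -!quotient_mapZ scalerDr quotient_mapD.
Qed.

Fact quotient_scaleDl S (a : quotient_space S) :
  {morph (@quotient_scale S)^~ a : c d / c + d}.
Proof.
move=> c d; have [v <-] := quotient_map_surj a.
by rewrite -!quotient_mapZ scalerDl quotient_mapD.
Qed.

HB.instance Definition _ S := GRing.Zmodule_isLmodule.Build K (quotient_space S)
  (@quotient_scaleA S) (@quotient_scale1 S) (@quotient_scaleDr S)
  (@quotient_scaleDl S).

(* The set below has at most one element, namely the class of all the products
   mul u v of representatives; it is nonempty exactly when mul is compatible
   with the quotient at (a, b). *)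
Definition induced_mul S (mul : V -> V -> V) (a b : quotient_space S) :
    quotient_space S :=
  xget 0 [set c | forall u v, quotient_map S u = a -> quotient_map S v = b ->
                    quotient_map S (mul u v) = c].

Section DirectSum.
Variables (I : choiceType) (W : I -> set V).

Definition decomposition (v : V) : set (I -> V) :=
  [set x | [/\ finite_set [set i | x i != 0], (forall i, W i (x i)) &
               v = \sum_(i \in [set: I]) x i]].

Definition is_direct_sum : Prop :=
  forall v, exists! x : I -> V, decomposition v x.

Definition component (v : V) : I -> V := xget (fun=> 0) (decomposition v).
End DirectSum.

End LinearAlgebra.

(* No axioms are required of the product, so that a quotient with its induced
   product can be formed without a prior proof that it is an associative
   algebra; isomorphisms preserve the linear structure, the identity and the
   product. *)
Record algebra_data (K : fieldType) := AlgebraData {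
  alg_space :> lmodType K;
  alg_one : alg_space;
  alg_mul : alg_space -> alg_space -> alg_space }.

Definition algebra_isomorphic (K : fieldType) (A B : algebra_data K) : Prop :=
  exists f : {linear A -> B},
    [/\ bijective f, f (alg_one A) = alg_one B &
        {morph f : a b / alg_mul a b >-> alg_mul a b}].

Definition quotient_algebra (K : fieldType) (V : lmodType K) (O : set V)
    (mul : V -> V -> V) (one : V) : algebra_data K :=
  @AlgebraData K (quotient_space O) (quotient_map O one) (induced_mul mul).

Section FormalSeries.
Variable K : fieldType.

(* A power series is given by its coefficients nat -> K, a Laurent series by
   its coefficients int -> K. *)

Definition gbinom (a : K) (k : nat) : K :=
  (\prod_(i < k) (a - i%:R)) / k`!%:R.

(* Coefficient of x^(k-i) y^i in (x - y)^k, for k an integer. *)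
Definition sub_expansion (k : int) (i : nat) : K :=
  (-1) ^+ i * gbinom k%:~R i.

Definition ps_one : nat -> K := fun k => (k == 0%N)%:R.
Definition ps_mul (p q : nat -> K) : nat -> K :=
  fun k => \sum_(i < k.+1) p i * q (k - i)%N.
Definition ps_exp (p : nat -> K) (N : nat) : nat -> K := iter N (ps_mul p) ps_one.

(* Inverse of a power series p with constant term 1, as the geometric series in
   1 - p; only the first k + 1 terms contribute to the coefficient of x^k. *)
Definition ps_inv (p : nat -> K) : nat -> K :=
  fun k => \sum_(j < k.+1) ps_exp (fun i => ps_one i - p i) j k.

Lemma ps_exp_small (q : nat -> K) (N k : nat) :
  q 0%N = 0 -> (k < N)%N -> ps_exp q N k = 0.
Proof.
move=> q0; elim: N k => [//|N IH] k kN; rewrite /ps_exp iterS /ps_mul.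
apply: big1 => -[[|i] /= ik] _; first by rewrite q0 mul0r.
rewrite [X in _ * X]IH ?mulr0 //; apply: leq_trans (kN : (k <= N)%N).
by rewrite -subSn ?subSS ?leq_subr.
Qed.

Lemma ps_mul_inv (p : nat -> K) : p 0%N = 1 -> ps_mul p (ps_inv p) =1 ps_one.
Proof.
move=> p0 k; pose q i := ps_one i - p i.
have q0 : q 0%N = 0 by rewrite /q p0 /ps_one eqxx subrr.
have one_mul r j : ps_mul ps_one r j = r j.
  rewrite /ps_mul big_ord_recl /= subn0 big1 => [|i _].
    by rewrite /ps_one mul1r addr0.
  by rewrite /ps_one mul0r.
have tele j : ps_mul p (ps_exp q j) k = ps_exp q j k - ps_exp q j.+1 k.
  rewrite [ps_exp q j.+1]/ps_exp iterS -/(ps_exp q j) -[X in X - _](one_mul (ps_exp q j)).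
  rewrite -sumrB; apply: eq_bigr => i _.
  by rewrite -mulrBl /q subKr.
transitivity (\sum_(j < k.+1) ps_mul p (ps_exp q j) k).
  rewrite exchange_big /=; apply: eq_bigr => i _; rewrite -mulr_sumr; congr *%R.
  rewrite /ps_inv -/q (big_ord_widen k.+1 (fun j => ps_exp q j (k - i)%N)).
    rewrite big_mkcond /=; apply: eq_bigr => j _; case: ifPn => //.
    by rewrite -leqNgt => ?; rewrite ps_exp_small.
  by rewrite ltnS leq_subr.
under eq_bigr do rewrite tele.
have telescope N : \sum_(j < N) (ps_exp q j k - ps_exp q j.+1 k)
    = ps_one k - ps_exp q N k.
  elim: N => [|N IH]; first by rewrite big_ord0 subrr.
  by rewrite big_ord_recr /= IH subrKA.
by rewrite telescope ps_exp_small ?subr0.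
Qed.

(* x^(-N) p(x) *)
Definition laurent (N : nat) (p : nat -> K) : int -> K :=
  fun j => if j + N%:Z is Posz k then p k else 0.

(* (1 + x)^a / x^N *)
Definition binomial_laurent (a : K) (N : nat) : int -> K := laurent N (gbinom a).

(* e^(a x) / (e^x - 1)^N, with e^x - 1 = x * \sum_k x^k / (k+1)! *)
Definition exp_laurent (a : K) (N : nat) : int -> K :=
  laurent N (ps_mul (fun k => a ^+ k / k`!%:R)
                    (ps_exp (ps_inv (fun k => (k.+1)`!%:R^-1)) N)).

End FormalSeries.

Section VertexAlgebras.
Variable R : realType.
Local Notation C := R[i].

(* mode u n is the coefficient u_n of x^(-n-1) in Y(u, x). The Jacobi identity
   is read off at z0^(-l-1) z1^(-m-1) z2^(-n-1). *)
Record vertex_algebra (V : lmodType C) := VertexAlgebra {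
  mode : V -> int -> V -> V;
  vac : V;
  mode_linearl : forall (n : int) (v : V), linear (fun u => mode u n v);
  mode_linearr : forall (u : V) (n : int), linear (mode u n);
  mode_vac : forall (n : int) (v : V),
    mode vac n v = if n == -1 then v else 0;
  mode_creation : forall (u : V) (n : int), -1 <= n ->
    mode u n vac = if n == -1 then u else 0;
  mode_truncation : forall u v : V, exists N : int, forall n : int,
    N <= n -> mode u n v = 0;
  mode_jacobi : forall (u v w : V) (l m n : int),
    \sum_(i \in [set: nat]) sub_expansion C l i *:
        mode u (m + l - i%:Z) (mode v (n + i%:Z) w)
    - (-1 : C) ^ l *: \sum_(i \in [set: nat]) sub_expansion C l i *:
        mode v (n + l - i%:Z) (mode u (m + i%:Z) w)
    = \sum_(i \in [set: nat]) sub_expansion C (i%:Z - m - 1) i *: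
        mode (mode u (l + i%:Z) v) (m + n - i%:Z) w }.

Variables (V : lmodType C) (VA : vertex_algebra V).

Definition calD (v : V) : V := mode VA v (-2) (vac VA).

Definition Lop (omega : V) (n : int) : V -> V := mode VA omega (n + 1).

Definition weight_space (omega : V) (c : C) : set V :=
  [set v | Lop omega 0 v = c *: v].

Record conformal_vector (omega : V) : Prop := ConformalVector {
  conformal_virasoro : exists c : C, forall (m n : int) (v : V),
    Lop omega m (Lop omega n v) - Lop omega n (Lop omega m v) =
    (m - n)%:~R *: Lop omega (m + n) v +
    (if m + n == 0 then ((m ^+ 3 - m)%:~R / 12 * c) *: v else 0);
  conformal_Lm1 : forall v, Lop omega (-1) v = calD v;
  conformal_L0 : is_direct_sum (weight_space omega);
  conformal_nilpotent : forall n : int, 1 <= n -> forall v,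
    exists k : nat, iter k (Lop omega n) v = 0 }.

Record vertex_operator_algebra (omega : V) : Prop := VertexOperatorAlgebra {
  voa_conformal : conformal_vector omega;
  voa_integer : forall (c : C) (v : V), weight_space omega c v -> v != 0 ->
    exists m : int, c = m%:~R;
  voa_finite_dim : forall m : int, exists (d : nat) (b : 'I_d -> V),
    (forall i, weight_space omega m%:~R (b i)) /\
    forall v, weight_space omega m%:~R v ->
      exists a : 'I_d -> C, v = \sum_i a i *: b i;
  voa_bounded_below : exists N : int, forall m : int, m < N ->
    forall v, weight_space omega m%:~R v -> v = 0 }.

Record automorphism (omega : V) (g : {linear V -> V}) : Prop := Automorphism {
  aut_bij : bijective g;
  aut_vac : g (vac VA) = vac VA;
  aut_mode : forall (u : V) (n : int) (v : V),
    g (mode VA u n v) = mode VA (g u) n (g v);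
  aut_conformal : g omega = omega }.

Definition has_order (g : V -> V) (T : nat) : Prop :=
  [/\ (0 < T)%N, iter T g =1 id &
      forall k : nat, (0 < k < T)%N -> ~ (iter k g =1 id)].

(* e^(- 2 pi sqrt(-1) r / T) *)
Definition root_of_unity (T r : nat) : C :=
  let theta : R := - (2 * pi * r%:R / T%:R) in
  Complex (cos theta) (sin theta).

Definition gspace (g : V -> V) (T : nat) (r : 'I_T) : set V :=
  [set v | g v = root_of_unity T r *: v].

(* Res_x f(x) Y(u, x) v *)
Definition residue (f : int -> C) (u v : V) : V :=
  \sum_(j \in [set: int]) f j *: mode VA u j v.

(* For n in (1/T)N: the integer \bar n with n = floor n + \bar n / T; the floor
   itself is Num.truncn n. *)
Definition nbar (T : nat) (n : rat) : nat :=
  Num.truncn (T%:R * (n - (Num.truncn n)%:R)).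

(* Since \bar n < T, the convention delta_{\bar n}(T) = 0 is automatic. *)
Definition delta (k l : nat) : nat := (l <= k)%N.

Definition pole_order (T : nat) (n : rat) (r : nat) : nat :=
  (2 * Num.truncn n + delta (nbar T n) r + delta (nbar T n) (T - r) + 1)%N.

Definition twist_exponent (T : nat) (n : rat) (r : nat) : C :=
  (delta (nbar T n) r)%:R + (Num.truncn n)%:R + r%:R / T%:R.

Section AlgebraA.
Variables (omega : V) (g : V -> V) (T : nat) (n : rat).

Definition bigraded_space (p : 'I_T * C) : set V :=
  gspace g p.1 `&` weight_space omega p.2.

Definition circ_hom (r : 'I_T) (wt : C) (u v : V) : V :=
  residue (binomial_laurent (wt - 1 + twist_exponent T n r)
             (pole_order T n r)) u v.

Definition star_hom (r : 'I_T) (wt : C) (u v : V) : V :=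
  if (r : nat) == 0%N then
    let fn := Num.truncn n in
    \sum_(m < fn.+1) ((-1) ^+ m * ('C(m + fn, fn))%:R) *:
      residue (binomial_laurent (wt + fn%:R) (fn + m + 1)%N) u v
  else 0.

(* Linear extensions in u from the spaces V^r \cap V_wt. *)
Definition circ (u v : V) : V :=
  \sum_(p \in [set: 'I_T * C])
    circ_hom p.1 p.2 (component bigraded_space u p) v.

Definition star (u v : V) : V :=
  \sum_(p \in [set: 'I_T * C])
    star_hom p.1 p.2 (component bigraded_space u p) v.

Definition O_gens : set V :=
  [set x | exists u v, x = circ u v] `|`
  [set x | exists u, x = Lop omega (-1) u + Lop omega 0 u].

Definition A_algebra : algebra_data C := quotient_algebra O_gens star (vac VA).
End AlgebraA.

Section AlgebraAtilde.
Variables (g : V -> V) (T : nat) (n : rat).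

Definition diamond_hom (r : 'I_T) (u v : V) : V :=
  residue (exp_laurent (twist_exponent T n r) (pole_order T n r)) u v.

Definition bullet_hom (r : 'I_T) (u v : V) : V :=
  if (r : nat) == 0%N then
    let fn := Num.truncn n in
    \sum_(m < fn.+1) ((-1) ^+ m * ('C(m + fn, fn))%:R) *:
      residue (exp_laurent (fn.+1)%:R (fn + m + 1)%N) u v
  else 0.

(* Linear extensions in u from the spaces V^r. *)
Definition diamond (u v : V) : V :=
  \sum_(r < T) diamond_hom r (component (gspace g (T := T)) u r) v.

Definition bullet (u v : V) : V :=
  \sum_(r < T) bullet_hom r (component (gspace g (T := T)) u r) v.

Definition Otilde_gens : set V :=
  [set x | exists u v, x = diamond u v] `|` [set x | exists u, x = calD u].

Definition Atilde_algebra : algebra_data C :=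
  quotient_algebra Otilde_gens bullet (vac VA).
End AlgebraAtilde.

End VertexAlgebras.

(* Main.v *)
Require Import Defs.
From HB Require Import structures.
From mathcomp Require Import all_boot all_order all_algebra.
From mathcomp Require Import complex ring zify.
From mathcomp Require Import boolp classical_sets functions cardinality fsbigop.
From mathcomp Require Import reals trigo.

Set Implicit Arguments.
Unset Strict Implicit.
Unset Printing Implicit Defensive.
Import Order.TTheory GRing.Theory Num.Theory.
Local Open Scope ring_scope.

(** The change of coordinate z = e^x - 1 turns the residues that define the
    products of A_{g,n}(V,omega) into those that define the products of
    \tilde A_{g,n}(V).  Precisely, put Y[u,x] = Y(e^{x L(0)} u, e^x - 1).  The
    substitution gives
      Res_z (1+z)^(wt u - 1 + a) z^(-N) Y(u,z) v
        = Res_x e^(a x) (e^x - 1)^(-N) Y[u,x] v,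
    and the coefficient of x in Y[u,x] 1 is L(-1)u + L(0)u.  Hence every linear
    bijection Phi of V that fixes the vacuum, commutes with g and satisfies
      Phi (Y(u,x) v) = Y[Phi u, x] Phi v
    carries the generators of \tilde O onto those of O and the product of the
    former algebra to that of the latter, and so induces an isomorphism
    (quotient_algebra_iso).

    To build Phi (Zhu, Huang), deform the coordinate: f_s(x) = (e^(s x) - 1)/s
    goes from x at s = 0 to e^x - 1 at s = 1 along the flow of the vector field
    v_s(z) d/dz with v_s(z) = \sum_(j >= 1) a_j s^(j-1) z^(j+1) and
    a_j = (-1)^(j+1) / (j (j+1)).  Let A_s = \sum_(j >= 1) a_j s^(j-1) L(j) be
    the operator of this vector field and Y_s[u,x] the vertex operator in the
    coordinate f_s.  The commutator formula for [L(j), Y(u,z)] gives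
      [A_s, Y_s[u,x]] = Y_s[A_s u, x] + d/ds Y_s[u,x],
    which is bracket_mode_commutator.  If Phi_s = \sum_k s^k Phi_k solves
    d/ds Phi_s = A_s Phi_s with Phi_0 = id, then Phi_s (Y(u,x) v) and
    Y_s[Phi_s u, x] Phi_s v solve the same initial value problem, whence they
    agree (coord_coef_mode).  Each Phi_k lowers weights by k and the weights are
    bounded below, so that s = 1 makes sense, and Phi = \sum_k Phi_k is bijective
    because it is the identity up to terms of lower weight.

    Since u enters the products of A_{g,n}(V,omega) through its components in
    the spaces V^r \cap V_w, the proof also needs the decomposition of V into
    these spaces; it comes from the projections (1/T) \sum_k zeta^(-rk) g^k,
    which commute with L(0). *)

(** * Formal power series *)

(** A copy of the type of functions, whose own ring structure is the pointwise one. *)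
Definition series (K : numFieldType) := nat -> K.

HB.instance Definition _ (K : numFieldType) := gen_eqMixin (series K).
HB.instance Definition _ (K : numFieldType) := gen_choiceMixin (series K).
HB.instance Definition _ (K : numFieldType) :=
  GRing.Zmodule.copy (series K) (nat -> K).

Section SeriesRing.
Variable K : numFieldType.
Implicit Types p q r : series K.

(** Products of series agree with products of polynomials in low degree, which
    is where the ring axioms come from. *)
Definition truncation (n : nat) p : {poly K} := \poly_(i < n.+1) p i.

Lemma seriesP p q : (forall k, p k = q k) -> p = q.
Proof. by move=> h; apply/funext. Qed.

Lemma seriesD p q k : (p + q) k = p k + q k. Proof. by []. Qed.
Lemma seriesN p k : (- p) k = - p k. Proof. by []. Qed.

Lemma coef_truncation n p i : (i <= n)%N -> (truncation n p)`_i = p i.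
Proof. by move=> h; rewrite coef_poly ltnS h. Qed.

Lemma ps_mul_truncation n p q k : (k <= n)%N ->
  ps_mul p q k = (truncation n p * truncation n q)`_k.
Proof.
move=> kn; rewrite coefM; apply: eq_bigr => -[i /= ik] _.
by rewrite !coef_truncation // ?(leq_trans _ kn) ?leq_subr.
Qed.

Lemma ps_mulC : commutative (@ps_mul K).
Proof. by move=> p q; apply/seriesP => k; rewrite !(@ps_mul_truncation k) // mulrC. Qed.

Lemma ps_mulA : associative (@ps_mul K).
Proof.
move=> p q r; apply/seriesP => k.
transitivity ((truncation k p * truncation k q * truncation k r)`_k).
  rewrite -mulrA coefM; apply: eq_bigr => -[i /= ik] _.
  by rewrite coef_truncation -?ps_mul_truncation ?leq_subr.
rewrite coefM; apply: eq_bigr => -[i /= ik] _.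
by rewrite coef_truncation ?leq_subr // -ps_mul_truncation.
Qed.

Lemma ps_mul1 : left_id (@ps_one K) (@ps_mul K).
Proof.
move=> p; apply/seriesP => k; rewrite /ps_mul big_ord_recl subn0 /= mul1r.
by rewrite big1 ?addr0 // => i _; rewrite mul0r.
Qed.

Lemma ps_mulDl : left_distributive (@ps_mul K) +%R.
Proof.
move=> p q r; apply/seriesP => k; rewrite seriesD /ps_mul -big_split /=.
by apply: eq_bigr => i _; rewrite seriesD mulrDl.
Qed.

Lemma ps_one_neq0 : ps_one K != 0 :> series K.
Proof. by apply/eqP => /(congr1 (fun p => p 0%N)) /eqP;
    rewrite /ps_one /= oner_eq0. Qed.

HB.instance Definition _ := GRing.Zmodule_isComNzRing.Build (series K)
  ps_mulA ps_mulC ps_mul1 ps_mulDl ps_one_neq0.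

Lemma seriesM p q k : (p * q) k = \sum_(i < k.+1) p i * q (k - i)%N.
Proof. by []. Qed.

Lemma series1 k : (1 : series K) k = (k == 0%N)%:R. Proof. by []. Qed.

Definition const (c : K) : series K := fun k => if k == 0%N then c else 0.

Lemma constM c p k : (const c * p) k = c * p k.
Proof.
rewrite seriesM big_ord_recl subn0 /= big1 ?addr0 // => i _.
by rewrite mul0r.
Qed.

Lemma const_zmod : zmod_morphism const.
Proof. by move=> c d; apply/seriesP => -[|k];
    rewrite !seriesD !seriesN /const //= subrr. Qed.
Lemma const_monoid : monoid_morphism const.
Proof.
split; first by apply/seriesP => -[|k].
by move=> c d; apply/seriesP => -[|k]; rewrite constM /const //= mulr0.
Qed.
HB.instance Definition _ := GRing.isZmodMorphism.Build K (series K) const const_zmod.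
HB.instance Definition _ := GRing.isMonoidMorphism.Build K (series K) const
  const_monoid.

Definition unit_series : {pred series K} := fun p => p 0%N != 0.
Definition inv_series p : series K :=
  if p \in unit_series then const (p 0%N)^-1 * ps_inv (const (p 0%N)^-1 * p) else p.

Lemma mul0_series p q : (p * q) 0%N = p 0%N * q 0%N.
Proof. by rewrite seriesM big_ord1. Qed.

Lemma mulV_series : {in unit_series, left_inverse 1 inv_series *%R}.
Proof.
move=> p pu; rewrite /inv_series pu mulrAC; apply/seriesP.
by apply: ps_mul_inv; rewrite constM mulVf.
Qed.

Lemma unit_seriesP p q : q * p = 1 -> p \in unit_series.
Proof.
move=> /(congr1 (fun p => p 0%N)); rewrite mul0_series series1 eqxx => h.
by apply: contra_eq_neq h => ->; rewrite mulr0 eq_sym oner_eq0.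
Qed.

Lemma inv_series_out : {in [predC unit_series], inv_series =1 id}.
Proof. by move=> p; rewrite inE /inv_series => /negbTE ->. Qed.

HB.instance Definition _ := GRing.ComNzRing_hasMulInverse.Build (series K)
  mulV_series unit_seriesP inv_series_out.

Lemma unit_seriesE p : (p \is a GRing.unit) = (p 0%N != 0).
Proof. by []. Qed.

Lemma inv_ps_inv p : p 0%N = 1 -> ps_inv p = p^-1.
Proof.
move=> p0; have pu : p \is a GRing.unit by rewrite unit_seriesE p0 oner_eq0.
apply: (mulrI pu); rewrite divrr //; apply/seriesP; exact: ps_mul_inv.
Qed.

Lemma ps_expE p N : ps_exp p N = p ^+ N.
Proof. by elim: N => // N IH; rewrite exprS -IH. Qed.

Definition serX : series K := fun k => (k == 1%N)%:R.

Lemma serXM p k : (serX * p) k = if k is k'.+1 then p k' else 0.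
Proof.
case: k => [|k]; first by rewrite mul0_series mul0r.
rewrite seriesM big_ord_recl mul0r add0r big_ord_recl /= mul1r subn1 /=.
by rewrite big1 ?addr0 // => i _; rewrite /serX /= mul0r.
Qed.

Lemma serXI p q : serX * p = serX * q -> p = q.
Proof.
move=> h; apply/seriesP => k.
by move/(congr1 (fun r => r k.+1)): h; rewrite !serXM.
Qed.

Definition der p : series K := fun k => k.+1%:R * p k.+1.

Lemma derD p q : der (p + q) = der p + der q.
Proof. by apply/seriesP => k; rewrite /der !seriesD mulrDr. Qed.
Lemma derN p : der (- p) = - der p.
Proof. by apply/seriesP => k; rewrite /der !seriesN mulrN. Qed.
Lemma der1 : der 1 = 0.
Proof. by apply/seriesP => k; rewrite /der series1 mulr0. Qed.
Lemma der_serX : der serX = 1.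
Proof. by apply/seriesP => -[|k]; rewrite /der series1 /serX ?mulr1 ?mulr0. Qed.

Lemma derM p q : der (p * q) = der p * q + p * der q.
Proof.
apply/seriesP => k; rewrite seriesD !seriesM /der seriesM mulr_sumr.
transitivity (\sum_(i < k.+2) i%:R * p i * q (k.+1 - i)%N +
              \sum_(i < k.+2) p i * ((k.+1 - i)%:R * q (k.+1 - i)%N)).
  rewrite -big_split; apply: eq_bigr => -[i /= ik] _.
  by rewrite -{1}(subnKC (ik : (i <= k.+1)%N)) natrD; ring.
congr (_ + _).
  by rewrite big_ord_recl !mul0r add0r; apply: eq_bigr => i _; rewrite subSS.
rewrite big_ord_recr /= subnn mul0r mulr0 addr0.
by apply: eq_bigr => -[i /= ik] _; rewrite subSn.
Qed.

(** The coefficient of X^k in the equation (1 + X) p' = a p determines p_(k+1)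
    from p_k, so that solutions are determined by their constant term. *)
Lemma binomial_ode_uniq (a : K) p q :
  (1 + serX) * der p = const a * p -> (1 + serX) * der q = const a * q ->
  p 0%N = q 0%N -> p = q.
Proof.
have step r : (1 + serX) * der r = const a * r ->
    forall k, r k.+1 = (a - k%:R) / k.+1%:R * r k.
  move=> h k; have /(congr1 (fun r => r k)) := h.
  rewrite mulrDl mul1r seriesD serXM constM => hk.
  have {}hk : k.+1%:R * r k.+1 = (a - k%:R) * r k.
    rewrite mulrBl -hk; case: k {hk} => [|k]; rewrite /der ?mul0r ?subr0 ?addr0 //.
    by ring.
  by rewrite mulrAC -hk mulrC mulKf // pnatr_eq0.
move=> /step hp /step hq e0; apply/seriesP => k; elim: k => // k IH.
by rewrite hp hq IH.
Qed.

Definition binom_series (a : K) : series K := gbinom a.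

Lemma binom_series0 a : binom_series a 0%N = 1.
Proof. by rewrite /binom_series /gbinom big_ord0 divr1. Qed.

Lemma binom_seriesS a k : k.+1%:R * binom_series a k.+1 = (a - k%:R) * binom_series a k.
Proof.
rewrite /binom_series /gbinom big_ord_recr /= factS natrM invfM.
have h : k.+1%:R != 0 :> K by rewrite pnatr_eq0.
move: (k.+1%:R) h (a - k%:R) (\prod_(i < k) _) (k`!%:R^-1) => x h y z t.
by rewrite (mulrC z) -!mulrA (mulrCA z) (mulrCA y) mulVKf.
Qed.

Lemma binom_series_ode a : (1 + serX) * der (binom_series a) = const a * binom_series a.
Proof.
apply/seriesP => k; rewrite mulrDl mul1r seriesD serXM constM /der binom_seriesS.
by case: k => [|k]; rewrite /=; ring.
Qed.

(** Both sides solve the differential equation of (1 + X)^(a + b). *)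
Lemma binom_seriesD a b : binom_series (a + b) = binom_series a * binom_series b.
Proof.
apply: (@binomial_ode_uniq (a + b)); first exact: binom_series_ode.
  transitivity (((1 + serX) * der (binom_series a)) * binom_series b +
      ((1 + serX) * der (binom_series b)) * binom_series a).
    by rewrite derM; ring.
  by rewrite !binom_series_ode rmorphD /=; ring.
by rewrite mul0_series !binom_series0 mulr1.
Qed.

Lemma binom_series_nat (n k : nat) : binom_series n%:R k = 'C(n, k)%:R.
Proof.
elim: k => [|k IH]; first by rewrite binom_series0 bin0.
have h : k.+1%:R != 0 :> K by rewrite pnatr_eq0.
apply: (mulfI h); rewrite binom_seriesS IH -natrM mul_bin_left natrM.
have [kn|nk] := leqP k n; first by rewrite natrB.
by rewrite bin_small // !mulr0.
Qed.

Lemma binom_series1 : binom_series 1 = 1 + serX.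
Proof.
by apply/seriesP => k; rewrite (binom_series_nat 1) seriesD series1 /serX;
    case: k => [|[|k]]; rewrite ?addr0 ?add0r.
Qed.

Definition scomp p q : series K := fun k => \sum_(i < k.+1) p i * (q ^+ i) k.

Section Composition.
Variable q : series K.
Hypothesis q0 : q 0%N = 0.

Lemma exp_small N k : (k < N)%N -> (q ^+ N) k = 0.
Proof. by move=> h; rewrite -ps_expE ps_exp_small. Qed.

(** Since q has no constant term, q^i has order at least i: the sum defining the
    composite may run over any range that contains [0, k]. *)
Lemma scompE p n k : (k <= n)%N -> scomp p q k = \sum_(i < n.+1) p i * (q ^+ i) k.
Proof.
move=> kn; rewrite /scomp (big_ord_widen n.+1 (fun i => p i * (q ^+ i) k)) //.
rewrite big_mkcond; apply: eq_bigr => i _; case: ifPn => //.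
by rewrite -leqNgt => h; rewrite exp_small ?mulr0.
Qed.

Lemma scomp1 : scomp 1 q = 1.
Proof.
apply/seriesP => k; rewrite /scomp big_ord_recl expr0 series1 mul1r big1 ?addr0 //.
by move=> i _; rewrite series1 mul0r.
Qed.

Lemma scompD p r : scomp (p + r) q = scomp p q + scomp r q.
Proof.
apply/seriesP => k; rewrite seriesD /scomp -big_split; apply: eq_bigr => i _.
by rewrite seriesD mulrDl.
Qed.

(** Compare the double sums of p_i r_j q^(i+j); the terms with i + j > k do not
    contribute to the coefficient of X^k. *)
Lemma scompM p r : scomp (p * r) q = scomp p q * scomp r q.
Proof.
apply/seriesP => k; rewrite seriesM.
transitivity (\sum_(i < k.+1) \sum_(j < k.+1) p i * r j * (q ^+ (i + j)) k).
  rewrite /scomp.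
  under eq_bigr => n _ do rewrite seriesM mulr_suml.
  under eq_bigr => n _ do
    rewrite (big_ord_widen k.+1 (fun i => p i * r (n - i)%N * (q ^+ n) k)) ?ltn_ord //
        big_mkcond /=.
  rewrite exchange_big; apply: eq_bigr => i _ /=.
  rewrite -big_mkcond /=.
  rewrite -(big_mkord (fun n => (i <= n)%N) (fun n => p i * r (n - i)%N * (q ^+ n) k)).
  rewrite -(big_mkord xpredT (fun j => p i * r j * (q ^+ (i + j)) k)).
  rewrite (big_cat_nat (n := i)) /= ?(ltnW (ltn_ord i)) //.
  rewrite big_nat_cond big1 ?add0r; last by move=> j /andP[/andP[_ h1] h2]; lia.
  rewrite [RHS](big_cat_nat (n := (k.+1 - i)%N)) ?leq_subr //=.
  rewrite [X in _ = _ + X]big_nat_cond [X in _ = _ + X]big1 ?addr0; last first.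
    by move=> j /andP[/andP[h1 h2] _]; rewrite exp_small ?mulr0 //; lia.
  rewrite -{1}(add0n (i : nat)) big_addn big_nat_cond [RHS]big_nat_cond.
  by apply: eq_big => [j|j _]; [lia|rewrite addnK addnC].
under [RHS]eq_bigr => l _ do
  rewrite (@scompE p k) 1?(@scompE r k) ?leq_subr -1?ltnS ?ltn_ord // mulr_suml.
rewrite [RHS]exchange_big; apply: eq_bigr => i _ /=.
under [RHS]eq_bigr => l _ do rewrite mulr_sumr.
rewrite [RHS]exchange_big; apply: eq_bigr => j _ /=.
rewrite exprD seriesM mulr_sumr; apply: eq_bigr => l _.
by rewrite mulrACA.
Qed.

Lemma der_exp N : der (q ^+ N.+1) = const N.+1%:R * q ^+ N * der q.
Proof.
elim: N => [|N IH]; first by rewrite expr1 expr0 rmorph1 !mul1r.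
rewrite exprS derM IH [in RHS]mulrS rmorphD rmorph1 /= !exprS; ring.
Qed.

Lemma der_scomp p : der (scomp p q) = scomp (der p) q * der q.
Proof.
apply/seriesP => k; rewrite {1}/der (@scompE p k.+1) // big_ord_recl.
rewrite expr0 series1 mulr0 add0r mulr_sumr.
under eq_bigr => i _ do
  rewrite mulrCA [_ * (q ^+ _) _](_ : _ = der (q ^+ (lift ord0 i)) k) // der_exp -mulrA
      constM.
rewrite seriesM.
under [RHS]eq_bigr => l _ do
  rewrite (@scompE _ k) -1?ltnS ?ltn_ord // mulr_suml.
rewrite exchange_big; apply: eq_bigr => i _ /=.
rewrite seriesM !mulr_sumr; apply: eq_bigr => l _.
by rewrite /der /=; ring.
Qed.

Lemma scompV p : p \is a GRing.unit -> scomp p^-1 q = (scomp p q)^-1.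
Proof.
move=> pu; have h : scomp p q * scomp p^-1 q = 1 by rewrite -scompM divrr // scomp1.
have cu : scomp p q \is a GRing.unit by apply/unitrPr; exists (scomp p^-1 q).
by apply: (mulrI cu); rewrite h divrr.
Qed.

Lemma scompXn p N : scomp (p ^+ N) q = scomp p q ^+ N.
Proof. by elim: N => [|N IH]; rewrite ?expr0 ?scomp1 // !exprS scompM IH. Qed.

Lemma scomp_serX : scomp serX q = q.
Proof.
apply/seriesP => -[|k]; first by rewrite /scomp big_ord1 mul0r q0.
rewrite /scomp big_ord_recl mul0r add0r big_ord_recl /= mul1r expr1.
by rewrite big1 ?addr0 // => i _; rewrite /serX /= mul0r.
Qed.

Lemma scomp_const c : scomp (const c) q = const c.
Proof.
apply/seriesP => k; rewrite /scomp big_ord_recl expr0 series1 /= big1 ?addr0.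
  by rewrite /const /=; case: (k == 0%N); rewrite ?mulr1 ?mulr0.
by move=> i _; rewrite mul0r.
Qed.

End Composition.
End SeriesRing.

(** * The substitution x = log(1 + z) *)

Section ChangeOfVariable.
Variable K : numFieldType.

(** The series log(1 + X) / X, a unit, so that its powers with negative exponents
    are defined. *)
Definition log_ratio : series K := fun k => (-1) ^+ k / k.+1%:R.
Definition log_series : series K := serX K * log_ratio.
Definition exp_series (a : K) : series K := fun k => a ^+ k / k`!%:R.
(** The series (e^X - 1) / X. *)
Definition expm1_ratio : series K := fun k => (k.+1)`!%:R^-1.

Lemma log_series0 : log_series 0%N = 0. Proof. by rewrite /log_series serXM. Qed.

Lemma log_ratio0 : log_ratio 0%N = 1. Proof. by rewrite /log_ratio expr0 divr1. Qed.

Lemma log_ratio_unit : log_ratio \is a GRing.unit.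
Proof. by rewrite unit_seriesE log_ratio0 oner_eq0. Qed.

Lemma der_log_series : (1 + serX K) * der log_series = 1.
Proof.
have h k : der log_series k = (-1) ^+ k.
  by rewrite /der /log_series serXM /log_ratio mulrCA divff ?mulr1 // pnatr_eq0.
apply/seriesP => -[|k]; rewrite mulrDl mul1r seriesD serXM series1 !h ?addr0 //.
by rewrite exprS /=; ring.
Qed.

Lemma exp_series0 a : exp_series a 0%N = 1.
Proof. by rewrite /exp_series expr0 fact0 divr1. Qed.

Lemma der_exp_series a : der (exp_series a) = const a * exp_series a.
Proof.
apply/seriesP => k; rewrite constM /der /exp_series factS natrM invfM exprS.
have h : k.+1%:R != 0 :> K by rewrite pnatr_eq0.
by rewrite mulrCA mulVKf // mulrA.
Qed.

Lemma exp_series1 : exp_series 1 = 1 + serX K * expm1_ratio.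
Proof.
apply/seriesP => -[|k]; rewrite seriesD serXM series1 ?exp_series0 ?addr0 //.
by rewrite add0r /exp_series expr1n mul1r.
Qed.

Lemma expm1_ratio0 : expm1_ratio 0%N = 1. Proof. by rewrite /expm1_ratio invr1. Qed.
Lemma expm1_ratio_unit : expm1_ratio \is a GRing.unit.
Proof. by rewrite unit_seriesE expm1_ratio0 oner_eq0. Qed.

(** (1 + X)^a is the only solution of its differential equation with constant
    term 1, and e^(a log(1 + X)) is one. *)
Lemma scomp_exp_log a : scomp (exp_series a) log_series = binom_series a.
Proof.
apply: (@binomial_ode_uniq _ a); last 2 first.
- exact: binom_series_ode.
- by rewrite binom_series0 /scomp big_ord1 expr0 series1 exp_series0 mul1r.
rewrite (der_scomp log_series0) der_exp_series (scompM log_series0) scomp_const.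
by rewrite mulrCA der_log_series mulr1.
Qed.

(** Substituting log(1 + X) in e^X = 1 + X ((e^X - 1)/X) gives
    X = log(1 + X) times the composite. *)
Lemma scomp_expm1_ratio_log : scomp expm1_ratio log_series = log_ratio^-1.
Proof.
apply: (mulrI log_ratio_unit); rewrite divrr ?log_ratio_unit //; apply: serXI.
have := scomp_exp_log 1; rewrite binom_series1 exp_series1 (scompD) scomp1 => /addrI.
by rewrite (scompM log_series0) (scomp_serX log_series0) mulr1 mulrA.
Qed.

(** For u of weight w, the mode of index m of Y[u,x] is the residue of
    log(1 + z)^m (1 + z)^(w-1) Y(u,z); its coefficient on the mode of index m + c
    of Y(u,z) is the coefficient of z^c in the series below. *)
Definition mode_change (w : K) (m : int) : series K :=
  log_ratio ^ m * binom_series (w - 1).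

Lemma mode_change0 w m : mode_change w m 0%N = 1.
Proof.
rewrite /mode_change mul0_series binom_series0 mulr1.
have h N : (log_ratio ^+ N) 0%N = 1.
  by elim: N => [//|N IH]; rewrite exprS mul0_series IH log_ratio0 mulr1.
case: m => N; first exact: h.
have : (log_ratio ^+ N.+1 * log_ratio ^- N.+1) 0%N =
    1 by rewrite divrr // unitrX // log_ratio_unit.
by rewrite mul0_series h mul1r NegzE.
Qed.

(** The residue form of the substitution x = log(1 + z): expanding
    e^(a x) (e^x - 1)^(-N) in powers of x and then each power x^(k - N) in powers
    of z yields z^(-N) (1 + z)^a. *)
Lemma exp_substitution (a w : K) (N n : nat) :
  \sum_(k < n.+1) (exp_series a * (expm1_ratio^-1) ^+ N) k *
     mode_change w (k%:Z - N%:Z) (n - k)%N = binom_series (w - 1 + a) n.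
Proof.
have lu := log_ratio_unit.
have e : scomp (exp_series a * (expm1_ratio^-1) ^+ N) log_series =
    binom_series a * log_ratio ^+ N.
  rewrite (scompM log_series0) scomp_exp_log (scompXn log_series0) (scompV log_series0)
      ?expm1_ratio_unit //.
  by rewrite scomp_expm1_ratio_log invrK.
transitivity ((scomp (exp_series a * (expm1_ratio^-1) ^+ N) log_series *
    (log_ratio ^- N * binom_series (w - 1))) n); last first.
  rewrite e -mulrA (mulrA (log_ratio ^+ N)) divrr ?unitrX // mul1r -binom_seriesD.
  by rewrite [a + _]addrC.
rewrite seriesM.
under [RHS]eq_bigr => l _ do
  rewrite (@scompE _ _ log_series0 _ n) -1?ltnS ?ltn_ord // mulr_suml.
rewrite [RHS]exchange_big; apply: eq_bigr => k _ /=.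
rewrite (eq_bigr (fun l : 'I_n.+1 => (exp_series a * expm1_ratio^-1 ^+ N) k *
   ((log_series ^+ k) l * (log_ratio ^- N * binom_series (w - 1)) (n - l)%N)));
       last by move=> l _; rewrite mulrA.
rewrite -mulr_sumr; congr (_ * _).
rewrite -seriesM /log_series exprMn -mulrA.
have -> : log_ratio ^+ k * (log_ratio ^- N * binom_series (w - 1)) =
    mode_change w (k%:Z - N%:Z).
  by rewrite /mode_change mulrA exprzDr // exprnN.
have dXX (p : series K) (j i : nat) : (j <= i)%N -> ((serX K) ^+ j * p) i = p (i - j)%N.
  elim: j i => [|j IH] [|i] //; rewrite ?expr0 ?mul1r ?subn0 //.
  by rewrite exprS -mulrA serXM ltnS => /IH ->.
by rewrite dXX // -ltnS.
Qed.

(** The coefficients a_j of the vector field of the flow at s = 1, that is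
    (1 + z) log(1 + z) - z = \sum_j a_j z^(j+1). *)
Definition flow_coef : series K :=
  fun j => if j is j'.+1 then (-1) ^+ j' / (j'.+1 * j'.+2)%:R else 0.

Lemma flow_coefE : flow_coef = (1 + serX K) * log_ratio - 1.
Proof.
apply/seriesP => -[|k]; rewrite seriesD seriesN mulrDl mul1r seriesD serXM series1
    /flow_coef /log_ratio.
  by rewrite addr0 expr0 divr1 subrr.
rewrite subr0 exprS natrM invfM.
have h : k.+1%:R != 0 :> K by rewrite pnatr_eq0.
have h' : k.+2%:R != 0 :> K by rewrite pnatr_eq0.
have e : k.+2%:R = k.+1%:R + 1 :> K by rewrite -natr1.
by move: h h'; rewrite e; move: (k.+1%:R) => x h h'; field; apply/andP.
Qed.

Lemma log_series_deriv : log_series = der (serX K * flow_coef).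
Proof.
rewrite flow_coefE mulrBr mulr1 mulrCA -/log_series derD derN der_serX derM
    der_log_series.
by rewrite derD der1 der_serX; ring.
Qed.

Lemma der_log_ratio_pow (m : int) : log_ratio * der (log_ratio ^ m) =
  const m%:~R * log_ratio ^ m * der log_ratio.
Proof.
have hN (N : nat) : log_ratio * der (log_ratio ^+ N) =
    const N%:R * log_ratio ^+ N * der log_ratio.
  elim: N => [|N IH]; first by rewrite expr0 der1 mulr0 [0%:R]/(0) rmorph0 !mul0r.
  rewrite exprS derM mulrDr (mulrCA log_ratio log_ratio) IH [in RHS]mulrS rmorphD
      rmorph1 /=; ring.
case: m => N; first exact: hN.
rewrite NegzE; set p := log_ratio ^+ N.+1.
have pu : p \is a GRing.unit by rewrite unitrX // log_ratio_unit.
rewrite -exprnN -/p; apply: (mulrI pu).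
have : der (p * p^-1) = 0 by rewrite divrr // der1.
rewrite derM => /eqP; rewrite addrC addr_eq0 => /eqP h.
rewrite (mulrCA p) h mulrN mulrA hN -/p mulrNz rmorphN /=.
rewrite mulrA (mulrCA p) divrr // mulr1 mulNr; congr (- _).
move: (const _) (der log_ratio) => c d; rewrite -[RHS]mulr1 -(divrr pu); ring.
Qed.

(** The transport equation along the flow.  The weight w contributes through the
    divergence log(1 + z) of the vector field. *)
Lemma mode_change_ode (w : K) (m : int) (C := mode_change w m) :
  serX K * der C = - (const m%:~R * (flow_coef * C) + der (serX K * flow_coef * C))
    + const w * (log_series * C).
Proof.
have dlogs := log_series_deriv.
rewrite (derM _ C) -dlogs flow_coefE.
have -> : const w = const (w - 1) + 1 by rewrite -(rmorph1 (@const K)) -rmorphD subrK.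
have hl : der log_series = log_ratio + serX K * der log_ratio by rewrite /log_series
    derM der_serX mul1r.
have log_ratioE : log_ratio * der C =
    const m%:~R * C * der log_ratio +
    log_ratio * (log_ratio ^ m * der (binom_series (w - 1))).
  by rewrite /C /mode_change derM mulrDr mulrA der_log_ratio_pow; ring.
have := binom_series_ode (w - 1); have := der_log_series; rewrite hl.
set G := binom_series (w - 1); set X := serX K => h1 h2.
have e1 : log_series * (1 + X) * (log_ratio ^ m * der G) =
    const (w - 1) * (log_series * C).
  by rewrite /C /mode_change -/G -mulrA (mulrCA (1 + X)) h2; ring.
have e2 : X * (1 + X) * (const m%:~R * C * der log_ratio) =
    const m%:~R * C * (1 - (1 + X) * log_ratio).
  by rewrite -[Y in Y - _]h1; ring.
have e3 : (1 + X) * log_series * der C = X * (1 + X) * (const m%:~R * C * der log_ratio)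
   + log_series * (1 + X) * (log_ratio ^ m * der G).
  transitivity ((1 + X) * X * (log_ratio * der C)); first by rewrite /log_series -/X;
      ring.
  by rewrite log_ratioE /log_series -/X -/G; ring.
move: e3; rewrite e1 e2 => e3.
apply/eqP; rewrite -subr_eq0; apply/eqP.
rewrite [LHS](_ : _ = (1 + X) * log_series * der
    C - (const m%:~R * C * (1 - (1 + X) * log_ratio) +
    const (w - 1) * (log_series * C))).
  by rewrite e3 subrr.
by rewrite /log_series -/X; ring.
Qed.

Lemma log_seriesE k : log_series k = k.+1%:R * flow_coef k.
Proof.
by rewrite log_series_deriv /der serXM.
Qed.

(** The coefficient of X^k in the transport equation.  This is the contribution
    of L(-1) and L(0) to the local identity below. *)
Lemma mode_change_rec (w : K) (m : int) (k : nat) :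
  k%:R * mode_change w m k = \sum_(j < k.+1)
     flow_coef j * (w * j.+1%:R - (m + k%:Z + 1)%:~R) * mode_change w m (k - j)%N.
Proof.
have /(congr1 (fun p => p k)) := mode_change_ode w m.
rewrite serXM seriesD seriesN seriesD !constM -mulrA.
have -> : der (serX K * (flow_coef * mode_change w m)) k =
    k.+1%:R * (flow_coef * mode_change w m) k.
  by rewrite /der serXM.
rewrite -mulrDl => h.
transitivity (- ((m + k%:Z + 1)%:~R * (flow_coef * mode_change w m) k) +
    w * (log_series * mode_change w m) k).
  rewrite -addrA rmorphD /= (intrD _ k 1) natr1 -h.
  by case: (k) => [|k']; rewrite ?mul0r // mulrC.
rewrite !seriesM -mulNr !mulr_sumr -big_split; apply: eq_bigr => j _ /=.
by rewrite log_seriesE; ring.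
Qed.

(** The mode of index -2 of Y[u,x] begins with u_(-2) + w u_(-1): this is the source
    of L(0)u in the coefficient of x in Y[u,x] 1. *)
Lemma mode_change_m2_1 (w : K) : mode_change w (- 2) 1 = w.
Proof.
have := mode_change_rec w (- 2) 1; rewrite big_ord_recl big_ord1 /=.
rewrite !mul0r add0r mul1r => ->; rewrite /bump /= mode_change0 mulr1 expr0.
by rewrite subr0; field.
Qed.

(** The (i+1)st divided derivative of the vector field is a_i (1 + z)^(-i). *)
Lemma flow_coef_binomial (i j : nat) : (0 < i <= j)%N ->
  flow_coef j * 'C(j.+1, i.+1)%:R = flow_coef i * binom_series (- i%:R) (j - i)%N.
Proof.
case: i => // i /= ij.
elim: j ij => [//|j IH].
rewrite leq_eqVlt => /orP[/eqP <-|]; first by rewrite binn subnn binom_series0.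
rewrite ltnS => ij; have {IH} := IH ij.
rewrite subSn //; set d := (j - _)%N => IH.
have h : d.+1%:R != 0 :> K by rewrite pnatr_eq0.
apply: (mulfI h); rewrite [RHS]mulrCA binom_seriesS -[RHS]mulrCA -IH {IH}.
case: j ij @d h => // j ij d h.
rewrite /flow_coef exprS.
have e : d.+1%:R * 'C(j.+3, i.+2)%:R = j.+3%:R * 'C(j.+2, i.+2)%:R :> K.
  by rewrite -!natrM; congr (_%:R); rewrite -[in RHS]/(j.+3.-1) mul_bin_down;
      congr muln; rewrite /d; lia.
have -> : - i.+1%:R - d%:R = - j.+1%:R :> K.
  by rewrite -opprD -natrD; congr (- (_%:R)); rewrite /d; lia.
rewrite mulrCA e !natrM.
have h1 : j.+1%:R != 0 :> K by rewrite pnatr_eq0.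
have h2 : j.+2%:R != 0 :> K by rewrite pnatr_eq0.
have h3 : j.+3%:R != 0 :> K by rewrite pnatr_eq0.
by move: h1 h2 h3; move: (_.+1%:R) (j.+2%:R) (j.+3%:R) => x y z h1 h2 h3; field;
    rewrite h1 h2 h3.
Qed.

(** A factor (1 + z)^(-i) lowers the weight from w to w - i, which is the weight
    of L(i)u: this is why the terms with L(i)u in [L(j), Y(u,z)] reassemble into
    vertex operators of L(i)u in the new coordinate. *)
Lemma mode_change_shift (w : K) (m : int) (i e : nat) : (0 < i)%N ->
  \sum_(l < e.+1) flow_coef (i + l)%N * 'C((i + l).+1, i.+1)%:R * mode_change w m
      (e - l)%N
  = flow_coef i * mode_change (w - i%:R) m e.
Proof.
move=> i0.
have -> : mode_change (w - i%:R) m = binom_series (- i%:R) * mode_change w m.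
  by rewrite /mode_change mulrCA -binom_seriesD (_ : w - i%:R - 1 = - i%:R + (w - 1))
      //; ring.
rewrite seriesM mulr_sumr; apply: eq_bigr => l _.
by rewrite flow_coef_binomial ?i0 ?leq_addr // addKn mulrA.
Qed.

End ChangeOfVariable.

(** * Finitely supported sums *)

Section FiniteSums.
Variable V : zmodType.

Lemma fsum_seq (I : choiceType) (s : seq I) (F : I -> V) :
  uniq s -> (forall i, i \notin s -> F i = 0) ->
  \sum_(i \in [set: I]) F i = \sum_(i <- s) F i.
Proof.
move=> us h; rewrite (@fsbigE _ _ _ _ _ s) //; last by move=> i _; exact: h.
by apply: eq_bigl => i; rewrite in_setT.
Qed.

Lemma fsum_nat (F : nat -> V) (M : nat) : (forall i, (M <= i)%N -> F i = 0) ->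
  \sum_(i \in [set: nat]) F i = \sum_(i < M) F i.
Proof.
move=> h; rewrite (@fsum_seq _ (iota 0 M)) ?iota_uniq //.
  by rewrite -(big_mkord xpredT F) /index_iota subn0.
by move=> i; rewrite mem_iota add0n -leqNgt => /h.
Qed.

Lemma sum_ord_widen (F : nat -> V) (M N : nat) : (M <= N)%N ->
  (forall i, (M <= i)%N -> F i = 0) -> \sum_(i < N) F i = \sum_(i < M) F i.
Proof.
move=> MN h; rewrite [RHS](big_ord_widen N F MN) [RHS]big_mkcond.
by apply: eq_bigr => i _; case: ltnP => // /h.
Qed.

(** Reindexing by n = b + j, for a summand that vanishes outside a triangle. *)
Lemma sum_antidiagonal (G : nat -> nat -> V) (M : nat) :
  (forall b j, (M <= b + j)%N -> G b j = 0) ->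
  \sum_(b < M) \sum_(j < M) G b j = \sum_(n < M) \sum_(j < n.+1) G (n - j)%N j.
Proof.
move=> h.
transitivity (\sum_(n < M) \sum_(j < M) if (j <= n)%N then G (n - j)%N j else 0);
    last first.
  apply: eq_bigr => n _; rewrite (big_ord_widen M (fun j => G (n - j)%N j)) ?ltn_ord //.
  by rewrite [RHS]big_mkcond.
rewrite exchange_big [RHS]exchange_big; apply: eq_bigr => -[j /= jM] _.
rewrite -(big_mkord xpredT (fun b => G b j)).
rewrite -(big_mkord xpredT (fun n => if (j <= n)%N then G (n - j)%N j else 0)).
rewrite [RHS](big_cat_nat (n := j)) /= ?(ltnW jM) //.
rewrite [X in _ = X + _]big_nat_cond [X in _ = X + _]big1 ?add0r; last first.
  by move=> i /andP[/andP[_ ij] _]; rewrite leqNgt ij.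
rewrite (big_cat_nat (n := (M - j)%N)) ?leq_subr //=.
rewrite [X in _ + X]big_nat_cond [X in _ + X]big1 ?addr0; last first.
  by move=> i /andP[/andP[ij _] _]; rewrite h //; lia.
rewrite -[X in _ = \sum_(X <= _ < _) _]add0n big_addn; apply: eq_bigr => i _.
by rewrite leq_addl addnK.
Qed.

End FiniteSums.

(** * Modes of a vertex algebra and the Virasoro operators *)

Section Modes.
Variables (R : realType) (V : lmodType R[i]) (VA : vertex_algebra V).
Local Notation C := R[i].
Local Notation md := (mode VA).

HB.instance Definition _ u n :=
  GRing.isLinear.Build C V V *:%R (md u n) (mode_linearr VA u n).

(** Makes the linearity of a mode in its first argument a canonical structure. *)
Definition mode_at (n : int) (v u : V) := md u n v.
HB.instance Definition _ n v :=
  GRing.isLinear.Build C V V *:%R (mode_at n v) (mode_linearl VA n v).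

Lemma mode0l n v : md 0 n v = 0.
Proof. exact: (linear0 (mode_at n v)). Qed.
Lemma modeDl n v u u' : md (u + u') n v = md u n v + md u' n v.
Proof. exact: (linearD (mode_at n v)). Qed.
Lemma modeZl n v a u : md (a *: u) n v = a *: md u n v.
Proof. exact: (linearZ_LR (mode_at n v)). Qed.
Lemma mode_suml n v I (s : seq I) (P : pred I) (F : I -> V) :
  md (\sum_(i <- s | P i) F i) n v = \sum_(i <- s | P i) md (F i) n v.
Proof. exact: (linear_sum (mode_at n v)). Qed.

Lemma sub_expansion0 i : sub_expansion C 0 i = (i == 0%N)%:R.
Proof.
rewrite /sub_expansion -[gbinom _ _]/(binom_series 0 i) (binom_series_nat C 0).
by case: i => [|i]; rewrite ?expr0 ?mul1r // bin0n mulr0.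
Qed.

Lemma sub_expansion_neg (m i : nat) :
  sub_expansion C (i%:Z - m%:Z - 1) i = 'C(m, i)%:R.
Proof.
rewrite /sub_expansion -binom_series_nat /binom_series /gbinom mulrA; congr (_ / _).
rewrite -[X in _ ^+ X](card_ord i) -prodr_const -big_split /=.
rewrite [RHS](reindex_inj rev_ord_inj) /=; apply: eq_bigr => -[j /= ji] _.
by rewrite natrB // !rmorphB /= -natr1 -!pmulrn; ring.
Qed.

(** The Jacobi identity at l = 0. *)
Lemma mode_commutator (m : nat) (x u w : V) (p : int) :
  md x m (md u p w) - md u p (md x m w) =
  \sum_(i < m.+1) 'C(m, i)%:R *: md (md x i u) (m%:Z + p - i%:Z) w.
Proof.
have := mode_jacobi VA x u w 0 m p.
have h i : (1 <= i)%N -> sub_expansion C 0 i = 0.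
  by rewrite sub_expansion0; case: i.
rewrite expr0z scale1r (@fsum_nat _ _ 1); last by move=> i /h ->; rewrite scale0r.
rewrite (@fsum_nat _ _ 1); last by move=> i /h ->; rewrite scale0r.
rewrite (@fsum_nat _ _ m.+1); last first.
  by move=> i mi; rewrite sub_expansion_neg bin_small // scale0r.
rewrite !big_ord1 !sub_expansion0 /= !scale1r !addr0 => ->.
by apply: eq_bigr => i _; rewrite sub_expansion_neg add0r.
Qed.

(** The Jacobi identity for u and the vacuum at l = -2 and m = 0: only one mode of
    the vacuum is nonzero, so that at most one term survives in each sum. *)
Lemma mode_calD (u w : V) (n : int) :
  md (calD VA u) n w = (- n)%:~R *: md u (n - 1) w.
Proof.
have se i : sub_expansion C (- 2) i = i.+1%:R.
  rewrite /sub_expansion -[gbinom _ _]/(binom_series (- 2) i).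
  elim: i => [|i IH]; first by rewrite binom_series0 expr0 mulr1.
  have h : i.+1%:R != 0 :> C by rewrite pnatr_eq0.
  apply: (mulfI h); rewrite mulrCA binom_seriesS exprS.
  transitivity ((2 + i%:R) * ((-1) ^+ i * binom_series (-2) i : C)); first by ring.
  by rewrite IH -natrD mulrC add2n.
have := mode_jacobi VA u (vac VA) w (- 2) 0 n.
have voff k v : k != -1 -> md (vac VA) k v = 0.
  by move=> /negbTE h; rewrite mode_vac h.
have von k v : k = -1 -> md (vac VA) k v = v by move=> ->; rewrite mode_vac eqxx.
have single (k : nat) (F : nat -> V) : (forall i, i != k -> F i = 0) ->
    \sum_(i \in [set: nat]) F i = F k.
  by move=> h; rewrite (@fsum_seq _ _ [:: k]) ?big_seq1 // => i; rewrite inE; exact: h.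
rewrite [X in _ = X -> _](single 0%N); last first.
  by move=> i i0; rewrite sub_expansion_neg bin0n (negbTE i0) scale0r.
rewrite sub_expansion_neg scale1r !addr0 add0r -/(calD VA u).
have -> : (-1 : C) ^ (- 2) = 1 by rewrite -exprnN sqrrN expr1n invr1.
rewrite scale1r -[md _ (0 + n) w]/(md (calD VA u) (0 + n) w) !add0r => <-;
    case: n => [[|k]|k].
- rewrite !fsbig1 ?subr0 ?scale0r // => i _; rewrite voff ?linear0 ?scaler0 //; lia.
- rewrite fsbig1 => [|i _]; last by rewrite voff ?linear0 ?scaler0 //; lia.
  rewrite (single k) => [|i ik]; last by rewrite voff ?scaler0 //; lia.
  rewrite von; last lia.
  rewrite sub0r se -scaleNr; congr (_ *: md u _ w); lia.
- rewrite (single k) => [|i ik]; last by rewrite voff ?linear0 ?scaler0 //; lia.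
  rewrite fsbig1 => [|i _]; last by rewrite voff ?scaler0 //; lia.
  rewrite von; last lia.
  rewrite subr0 se; congr (_ *: md u _ w); lia.
Qed.

Section LocalIdentity.
Variable omega : V.
Hypothesis conf : conformal_vector VA omega.
Local Notation L := (Lop VA omega).
Local Notation wt := (weight_space VA omega).

HB.instance Definition _ n := GRing.Linear.on (L n).

(** The relation [L(0), L(j)] = - j L(j). *)
Lemma Lop_weight (w : C) (j : nat) (u : V) : wt w u -> wt (w - j%:R) (L j u).
Proof.
move=> hu; rewrite /weight_space /=.
have [c vir] := conformal_virasoro conf.
have := vir 0 j u; rewrite hu linearZ /= add0r sub0r.
have -> : (if j%:Z == 0 then ((0 ^+ 3 - 0)%:~R / 12 * c) *: u else 0) = 0.
  by case: eqP => // _; rewrite expr0n subr0 !mul0r scale0r.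
rewrite addr0 => /eqP; rewrite subr_eq => /eqP ->.
by rewrite -scalerDl addrC; congr ((_ + _) *: _); rewrite mulrNz pmulrn.
Qed.

Lemma Lop_vac (j : nat) : L j (vac VA) = 0.
Proof. by rewrite /Lop mode_creation //; lia. Qed.

(** The commutator formula with the terms in L(-1)u and L(0)u made explicit; the
    remaining terms involve L(i)u with i >= 1 only. *)
Lemma Lop_mode (j : nat) (w : C) (u x : V) (p : int) : wt w u ->
  L j (md u p x) = md u p (L j x)
   + (w * j.+1%:R - (p + j%:Z + 1)%:~R) *: md u (p + j%:Z) x
   + \sum_(i < j) 'C(j.+1, i.+2)%:R *: md (L i.+1 u) (p + j%:Z - i.+1%:Z) x.
Proof.
move=> hu; have e : (j%:Z + 1) = j.+1 by lia.
rewrite -[LHS](subrK (md u p (L j x))) addrC -!addrA; congr (_ + _).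
rewrite /Lop e mode_commutator !big_ord_recl /= bin0 bin1 !scale1r addrA.
congr (_ + _); last first.
  apply: eq_bigr => i _; congr (_ *: md (md omega _ u) _ x); rewrite /= /bump /=; lia.
have -> : md omega 0 u = calD VA u by rewrite -(conformal_Lm1 conf).
rewrite mode_calD.
have -> : md omega (bump 0 0) u = w *: u by rewrite -hu.
rewrite modeZl scalerA.
have -> : j.+1%:Z + p - 0 - 1 = p + j%:Z by lia.
have -> : j.+1%:Z + p - (bump 0 0)%:Z = p + j%:Z by rewrite /bump; lia.
rewrite -scalerDl; congr (_ *: _); rewrite [LHS]addrC (mulrC w); congr (_ + _).
by rewrite -rmorphN; congr (_%:~R); lia.
Qed.

(** The coefficient of s^c in the mode of index m of Y_s[u,x], applied to x, for u
    of weight w.  The degree c is an integer, and negative degrees give 0, so that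
    sums over all indices need no side conditions. *)
Definition bracket_mode (w : C) (m : int) (c : int) (u x : V) : V :=
  if c is Posz c' then mode_change w m c' *: md u (m + c) x else 0.

Lemma bracket_mode_linear w m c u : linear (bracket_mode w m c u).
Proof.
case: c => c a x y; last by rewrite /= scaler0 addr0.
by rewrite /= linearP scalerDr !scalerA mulrC.
Qed.

HB.instance Definition _ w m c u :=
  GRing.isLinear.Build C V V *:%R (bracket_mode w m c u) (@bracket_mode_linear w m c u).

Lemma bracket_mode_suml w m c x M (F : nat -> V) (a : nat -> C) :
  bracket_mode w m c (\sum_(i < M) a i *: F i) x =
      \sum_(i < M) a i *: bracket_mode w m c (F i) x.
Proof.
case: c => c /=; last by rewrite big1 // => i _; rewrite scaler0.
rewrite mode_suml scaler_sumr; apply: eq_bigr => i _.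
by rewrite modeZl !scalerA mulrC.
Qed.

Lemma bracket_mode_scalel w m c a u x : bracket_mode w m c (a *: u) x =
  a *: bracket_mode w m c u x.
Proof. by case: c => c /=; rewrite ?scaler0 // modeZl !scalerA mulrC. Qed.

(** The local identity [A_s, Y_s[u,x]] = Y_s[A_s u, x] + d/ds Y_s[u,x], in degree
    e - 1 in s.  By the commutator formula, the terms with L(-1)u and L(0)u sum up
    to the derivative in s (mode_change_rec), and those with L(i)u for i >= 1 to
    the vertex operator of A_s u (mode_change_shift). *)
Lemma bracket_mode_commutator (w : C) (m : int) (e : int) (M : nat) (u x : V) :
  wt w u -> e < M%:Z ->
  \sum_(j < M) flow_coef C j *: L j (bracket_mode w m (e - j%:Z) u x) =
  \sum_(j < M) flow_coef C j *: bracket_mode w m (e - j%:Z) u (L j x)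
  + \sum_(i < M) flow_coef C i *: bracket_mode (w - i%:R) m (e - i%:Z) (L i u) x
  + e%:~R *: bracket_mode w m e u x.
Proof.
move=> hu eM.
have neg c w' u' x' : c < 0 -> bracket_mode w' m c u' x' = 0 by case: c.
case: e eM => [e|e] eM; last first.
  by rewrite !big1 ?scaler0 ?addr0 // => i _; rewrite neg ?linear0 ?scaler0 //; lia.
have trunc (F : nat -> V) : (forall i, (e < i)%N -> F i = 0) ->
  \sum_(i < M) F i = \sum_(i < e.+1) F i by apply: sum_ord_widen; lia.
rewrite (trunc (fun j => flow_coef C j *: L j (bracket_mode w m (e%:Z - j%:Z) u x)));
    last first.
  by move=> i ie; rewrite neg ?linear0 ?scaler0 //; lia.
rewrite (trunc (fun j => flow_coef C j *: bracket_mode w m (e%:Z - j%:Z) u (L j x)));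
    last first.
  by move=> i ie; rewrite neg ?linear0 ?scaler0 //; lia.
rewrite (trunc (fun i => flow_coef C i *: bracket_mode (w - i%:R) m (e%:Z - i%:Z)
    (L i u) x)); last first.
  by move=> i ie; rewrite neg ?linear0 ?scaler0 //; lia.
have bE w' (j : nat) u' x' : (j <= e)%N ->
    bracket_mode w' m (e%:Z - j%:Z) u' x' =
        mode_change w' m (e - j)%N *: md u' (m + e%:Z - j%:Z) x'.
  move=> je; have -> : e%:Z - j%:Z = (e - j)%N by lia.
  by rewrite /=; congr (_ *: md _ _ _); lia.
pose mc := mode_change w m.
transitivity (\sum_(j < e.+1) (flow_coef C j *: bracket_mode w m (e%:Z - j%:Z) u (L j x)
  + (flow_coef C j * (w * j.+1%:R - (m + e%:Z + 1)%:~R) * mc (e - j)%N) *: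
      md u (m + e%:Z) x
  + \sum_(i < j) (flow_coef C j * 'C(j.+1, i.+2)%:R * mc (e - j)%N) *:
       md (L i.+1 u) (m + e%:Z - i.+1%:Z) x)).
  apply: eq_bigr => -[j /= je] _; rewrite !bE // linearZ /= (Lop_mode _ _ _ hu).
  rewrite !subrK !scalerDr !scalerA -/(mc _); congr (_ + _ + _).
    by congr (_ *: _); ring.
  rewrite !scaler_sumr; apply: eq_bigr => i _; rewrite !scalerA; congr (_ *: _); ring.
rewrite big_split big_split /= -scaler_suml -mode_change_rec -/mc -addrA [RHS]addrAC
    -!addrA.
congr (_ + (_ + _)).
  by rewrite scalerA.
rewrite big_ord_recl big_ord0 add0r [RHS]big_ord_recl scale0r add0r.
(* What remains is a double sum over i < j, collected by the index i of L(i)u. *)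
pose W i := md (L i.+1 u) (m + e%:Z - i.+1%:Z) x.
pose G l i := if (l + i < e)%N then
  (flow_coef C (l + i).+1 * 'C((l + i).+2, i.+2)%:R * mc (e - (l + i).+1)%N) *: W i else
      0.
transitivity (\sum_(n < e) \sum_(i < n.+1) G (n - i)%N i).
  apply: eq_bigr => -[n /= ne] _; apply: eq_bigr => -[i /= ik] _.
  have ein : (n - i + i = n)%N by rewrite subnK // -ltnS.
  by rewrite /G ein ne.
rewrite -sum_antidiagonal; last by move=> b j; rewrite /G ltnNge => ->.
rewrite exchange_big; apply: eq_bigr => -[i /= ie] _.
rewrite -[bump 0 i]/(i.+1) bE // -/(W i) scalerA -[X in X * _]/(flow_coef C i.+1)
    -mode_change_shift // scaler_suml.
rewrite (@sum_ord_widen _ (fun l => G l i) (e - i)) ?leq_subr //; last first.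
  by move=> l; rewrite /G ltnNge => h; rewrite ifF //; lia.
have -> : (e - i.+1).+1 = (e - i)%N by lia.
apply: eq_bigr => -[l /= le] _; rewrite /G ifT; last lia.
rewrite (addnC l) !addSn; congr ((_ * mc _) *: _); lia.
Qed.

End LocalIdentity.

End Modes.

(** * The flow of the change of coordinate *)

Section CoordCoefs.
Variables (R : realType) (V : lmodType R[i]) (VA : vertex_algebra V).
Local Notation C := R[i].
Local Notation md := (mode VA).
Variable omega : V.
Hypothesis conf : conformal_vector VA omega.
Local Notation L := (Lop VA omega).
Local Notation wt := (weight_space VA omega).
Local Notation bracket_mode := (bracket_mode VA).

(** The solution of k Phi_k = \sum_(1 <= j <= k) a_j L(j) Phi_(k-j); the first
    argument bounds the depth of the recursion. *)
Fixpoint coord_coef_fuel (n k : nat) (v : V) : V :=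
  if n is n'.+1 then
    if k is 0%N then v else
    k%:R^-1 *: \sum_(j < k) flow_coef C j.+1 *: L j.+1%:Z
        (coord_coef_fuel n' (k - j.+1)%N v)
  else v.

Definition coord_coef (k : nat) (v : V) : V := coord_coef_fuel k k v.

Lemma coord_coef_fuel_stable n k v : (k <= n)%N -> coord_coef_fuel n k v =
  coord_coef k v.
Proof.
rewrite /coord_coef; elim/ltn_ind: n k => -[|n] IH [|k] // kn.
rewrite [LHS]/= [RHS]/=; congr (_ *: _); apply: eq_bigr => -[j /= jk] _.
by rewrite (IH n) 1?(IH k) //; lia.
Qed.

Lemma coord_coef0 v : coord_coef 0 v = v. Proof. by []. Qed.

Lemma coord_coef_rec (k : nat) v :
  k%:R *: coord_coef k v = \sum_(j < k.+1) flow_coef C j *: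
      L j%:Z (coord_coef (k - j)%N v).
Proof.
rewrite big_ord_recl scale0r add0r.
case: k => [|k]; first by rewrite scale0r big_ord0.
rewrite {1}/coord_coef [coord_coef_fuel _ _ _]/= scalerA divff ?pnatr_eq0 // scale1r.
by apply: eq_bigr => -[j /= jk] _; rewrite coord_coef_fuel_stable //; lia.
Qed.

(** The recursion determines its solution up to any given degree; the main
    identities for Phi_k are proved by exhibiting a second solution. *)
Lemma coord_coef_uniq (F : nat -> V) (v : V) (M : nat) : F 0%N = v ->
  (forall k, (k < M)%N -> k%:R *: F k =
      \sum_(j < k.+1) flow_coef C j *: L j%:Z (F (k - j)%N)) ->
  forall k, (k < M)%N -> F k = coord_coef k v.
Proof.
move=> F0 Frec; elim/ltn_ind => -[|k] IH kM; first by rewrite F0.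
apply: (@scalerI _ _ k.+1%:R); first by rewrite pnatr_eq0.
rewrite Frec // coord_coef_rec; apply: eq_bigr => -[[|j] /= jk] _;
    first by rewrite !scale0r.
by rewrite IH //; lia.
Qed.

Lemma coord_coef_linear k : linear (coord_coef k).
Proof.
move=> a u v; symmetry.
apply: (@coord_coef_uniq (fun k => a *: coord_coef k u + coord_coef k v) _ k.+1) => //
    {}k _.
rewrite scalerDr scalerA mulrC -scalerA !coord_coef_rec scaler_sumr -big_split.
apply: eq_bigr => j _ /=.
by rewrite linearP scalerDr !scalerA mulrC.
Qed.

HB.instance Definition _ k := GRing.isLinear.Build C V V *:%R (coord_coef k)
  (@coord_coef_linear k).

Lemma coord_coef_weight (w : C) k u : wt w u -> wt (w - k%:R) (coord_coef k u).
Proof.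
move=> hu; elim/ltn_ind: k => -[|k] IH; first by rewrite subr0.
have h : k.+1%:R != 0 :> C by rewrite pnatr_eq0.
have -> : coord_coef k.+1 u = k.+1%:R^-1 *: \sum_(j < k.+2) flow_coef C j *:
    L j%:Z (coord_coef (k.+1 - j)%N u).
  by rewrite -coord_coef_rec scalerA mulVf // scale1r.
rewrite /weight_space /= linearZ /= linear_sum /= scalerA mulrC -scalerA;
    congr (_ *: _).
rewrite scaler_sumr; apply: eq_bigr => -[[|j] jk] _;
    first by rewrite scale0r linear0 scaler0.
rewrite -![nat_of_ord (Ordinal jk)]/(j.+1); move: (flow_coef C _) => c.
rewrite linearZ /= scalerA mulrC -scalerA; congr (_ *: _).
have /(Lop_weight conf j.+1) :
    wt (w - (k.+1 - j.+1)%:R) (coord_coef (k.+1 - j.+1) u) by apply: IH; lia.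
rewrite /weight_space /= => h1; apply: etrans h1 _; congr (_ *: _); rewrite natrB //;
    ring.
Qed.

Lemma coord_coef_vac k : coord_coef k (vac VA) = if k == 0%N then vac VA else 0.
Proof.
symmetry; apply: (@coord_coef_uniq (fun k => if k == 0%N then vac VA else 0) _
    k.+1) => // {}k _.
rewrite big1 => [|[j jk] _]; first by case: k => *; rewrite ?scale0r ?scaler0.
by case: ifP => _ /=; rewrite ?Lop_vac ?linear0 ?scaler0.
Qed.

(** The degree k part of Phi_s (Y(u,x) v) = Y_s[Phi_s u, x] Phi_s v.  The right-hand
    side satisfies the recursion of Phi_k: by the local identity, A_s acting on it
    gives three sums, which are the derivatives in s of the three factors.  The
    bound M on the indices is arbitrary, as the terms with a + b > k vanish. *)
Lemma coord_coef_mode (w : C) (m : int) (u v : V) (M k : nat) : wt w u -> (k < M)%N ->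
  coord_coef k (md u m v) = \sum_(a < M) \sum_(b < M)
     bracket_mode (w - a%:R) m (k%:Z - a%:Z - b%:Z) (coord_coef a u) (coord_coef b v).
Proof.
move=> hu kM.
have neg c w' u' x' : c < 0 -> bracket_mode w' m c u' x' = 0 by case: c.
case: M kM => // M kM.
pose mu (a b : nat) (e : int) :=
    bracket_mode (w - a%:R) m (e - a%:Z - b%:Z) (coord_coef a u) (coord_coef b v).
pose X (k : nat) := \sum_(a < M.+1) \sum_(b < M.+1) mu a b k.
symmetry; move: k kM; apply: (@coord_coef_uniq X) => [|k kM].
  rewrite /X big_ord_recl [Y in _ + Y]big1 ?addr0 => [|a _]; last first.
    by rewrite big1 // => b _; rewrite /mu neg //= /bump /=; lia.
  rewrite big_ord_recl [Y in _ + Y]big1 ?addr0 => [|b _]; last first.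
    by rewrite /mu neg //= /bump /=; lia.
  by rewrite /mu /= mode_change0 scale1r addr0.
(* The terms with j > k vanish, so that j and the other indices share a range. *)
transitivity (\sum_(j < M.+1) \sum_(a < M.+1) \sum_(b < M.+1)
    flow_coef C j *: L j%:Z (mu a b (k%:Z - j%:Z))); last first.
  rewrite (@sum_ord_widen _ (fun j => \sum_(a < M.+1) \sum_(b < M.+1)
    flow_coef C j *: L j%:Z (mu a b (k%:Z - j%:Z))) k.+1) //; last first.
    move=> j kj; rewrite big1 // => a _; rewrite big1 // => b _.
    by rewrite /mu neg ?linear0 ?scaler0 //; lia.
  apply: eq_bigr => -[j /= jk] _; rewrite /X linear_sum scaler_sumr;
      apply: eq_bigr => a _.
  rewrite linear_sum scaler_sumr; apply: eq_bigr => b _ /=.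
  by congr (_ *: L _ (mu _ _ _)); lia.
rewrite exchange_big /=.
under [RHS]eq_bigr => a _ do rewrite exchange_big /=.
transitivity (\sum_(a < M.+1) \sum_(b < M.+1) (
   \sum_(j < M.+1) flow_coef C j *: bracket_mode (w - a%:R) m
       (k%:Z - a%:Z - b%:Z - j%:Z) (coord_coef a u) (L j%:Z (coord_coef b v))
   + \sum_(i < M.+1) flow_coef C i *: bracket_mode (w - a%:R - i%:R) m
       (k%:Z - a%:Z - b%:Z - i%:Z) (L i%:Z (coord_coef a u)) (coord_coef b v)
   + (k%:Z - a%:Z - b%:Z)%:~R *: mu a b k)); last first.
  apply: eq_bigr => a _; apply: eq_bigr => b _.
  have eM : k%:Z - a%:Z - b%:Z < M.+1%:Z by lia.
  rewrite -(bracket_mode_commutator conf m (coord_coef b v) (coord_coef_weight a hu)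
      eM).
  by apply: eq_bigr => j _; congr (_ *: L _ (bracket_mode _ _ _ _ _)); lia.
(* The recursion of Phi_b absorbs the terms where L(j) acts on the second factor. *)
have sumb (a : 'I_M.+1) : \sum_(b < M.+1) \sum_(j < M.+1)
    flow_coef C j *: bracket_mode (w - a%:R) m (k%:Z - a%:Z - b%:Z - j%:Z)
        (coord_coef a u) (L j%:Z (coord_coef b v))
    = \sum_(b < M.+1) b%:R *: mu a b k.
  rewrite (@sum_antidiagonal _ (fun b j : nat => flow_coef C j *:
    bracket_mode (w - a%:R) m (k%:Z - a%:Z - b%:Z - j%:Z) (coord_coef a u)
        (L j%:Z (coord_coef b v)))); last first.
    by move=> b j bj; rewrite neg ?scaler0 //; lia.
  apply: eq_bigr => -[b /= bM] _; rewrite /mu -linearZ /= coord_coef_rec linear_sum /=.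
  apply: eq_bigr => -[j /= jb] _; rewrite linearZ /=;
      congr (_ *: bracket_mode _ _ _ _ _); lia.
(* Likewise for the first factor. *)
have suma (b : 'I_M.+1) : \sum_(a < M.+1) \sum_(i < M.+1)
    flow_coef C i *: bracket_mode (w - a%:R - i%:R) m (k%:Z - a%:Z - b%:Z - i%:Z)
        (L i%:Z (coord_coef a u)) (coord_coef b v)
    = \sum_(a < M.+1) a%:R *: mu a b k.
  rewrite (@sum_antidiagonal _ (fun a i : nat => flow_coef C i *:
    bracket_mode (w - a%:R - i%:R) m (k%:Z - a%:Z - b%:Z - i%:Z)
        (L i%:Z (coord_coef a u)) (coord_coef b v))); last first.
    by move=> a i ai; rewrite neg ?scaler0 //; lia.
  apply: eq_bigr => -[a /= aM] _; rewrite /mu -bracket_mode_scalel coord_coef_rec.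
  rewrite (bracket_mode_suml VA _ _ _ _ _ (fun i => L i%:Z (coord_coef (a - i) u))
      (flow_coef C)).
  apply: eq_bigr => -[i /= ia] _; congr (_ *: _).
  have -> : w - (a - i)%:R - i%:R = w - a%:R by rewrite natrB //; ring.
  by congr (bracket_mode _ _ _ _ _); lia.
under [RHS]eq_bigr => a _ do rewrite !big_split /= sumb.
rewrite !big_split /= [X in _ = _ + X + _]exchange_big /=.
under [X in _ = _ + X + _]eq_bigr => b _ do rewrite suma.
rewrite [X in _ = _ + X + _]exchange_big /= -!big_split /X scaler_sumr.
apply: eq_bigr => a _; rewrite -!big_split scaler_sumr; apply: eq_bigr => b _ /=.
rewrite -!scalerDl; congr (_ *: _).
by rewrite !rmorphB /= -!pmulrn; ring.
Qed.

End CoordCoefs.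

(** * Direct sums and linear extension from homogeneous parts *)

Section DirectSums.
Variables (K : fieldType) (V : lmodType K) (I : choiceType) (W : I -> set V).

Lemma decompositionP (v : V) (x : I -> V) : decomposition W v x ->
  exists s : seq I, [/\ uniq s, forall i, i \notin s -> x i = 0,
    forall i, W i (x i) & v = \sum_(i <- s) x i].
Proof.
move=> [/finite_seqP [s hs] xW ->]; exists (undup s).
have h i : i \notin undup s -> x i = 0.
  rewrite mem_undup => his; apply/eqP/negPn/negP => h.
  have : [set i | x i != 0]%classic i by [].
  by rewrite hs /=; apply/negP.
by split=> //; [exact: undup_uniq | rewrite (fsum_seq (undup_uniq s))].
Qed.

Lemma decomposition_seq (v : V) (x : I -> V) (s : seq I) : uniq s ->
  (forall i, i \notin s -> x i = 0) -> (forall i, W i (x i)) ->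
  v = \sum_(i <- s) x i -> decomposition W v x.
Proof.
move=> us h xW ->; split=> //; last by rewrite (fsum_seq us).
apply: (@sub_finite_set _ _ [set` s]); last exact: finite_seq.
by move=> i /=; apply: contraNT => /h ->.
Qed.

Hypothesis ds : is_direct_sum W.

Lemma componentP v : decomposition W v (component W v).
Proof. by have [x [hx _]] := ds v; apply: (xgetPex (fun=> 0)); exists x. Qed.

Lemma componentE v x : decomposition W v x -> component W v = x.
Proof.
move=> hx; have [y [_ hy]] := ds v.
by rewrite -(hy _ (componentP v)) -(hy _ hx).
Qed.

(** The induction principle by which identities that are additive in a vector are
    reduced to homogeneous vectors. *)
Lemma direct_sum_ind (P : V -> Prop) : P 0 ->
  (forall u v, P u -> P v -> P (u + v)) ->
  (forall i u, W i u -> P u) -> forall v, P v.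
Proof.
move=> P0 PD PW v; have [s [_ _ xW ->]] := decompositionP (componentP v).
by apply: big_ind => // i _; exact: PW.
Qed.

Hypothesis W0 : forall i, W i 0.
Hypothesis WD : forall i u v, W i u -> W i v -> W i (u + v).

Lemma componentD u v : component W (u + v) = component W u \+ component W v.
Proof.
apply: componentE; have [s [us hs xW eu]] := decompositionP (componentP u).
have [t [ut ht yW ev]] := decompositionP (componentP v).
have uu := undup_uniq (s ++ t).
apply: (decomposition_seq uu) => [i||].
- by rewrite mem_undup mem_cat negb_or => /andP[/hs hi /ht hj] /=; rewrite hi hj addr0.
- by move=> i; apply: WD.
- rewrite big_split /= {1}eu {1}ev; congr (_ + _).
    rewrite -(fsum_seq us hs) (fsum_seq uu) // => i.
    by rewrite mem_undup mem_cat negb_or => /andP[/hs].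
  rewrite -(fsum_seq ut ht) (fsum_seq uu) // => i.
  by rewrite mem_undup mem_cat negb_or => /andP[_ /ht].
Qed.

Lemma component_hom i u : W i u -> component W u = fun j => if j == i then u else 0.
Proof.
move=> hu; apply: componentE; apply: (@decomposition_seq _ _ [:: i]) => //.
- by move=> j; rewrite inE => /negbTE ->.
- by move=> j; case: eqP => [->|_].
- by rewrite big_seq1 eqxx.
Qed.

Variable (F : I -> V -> V).
Hypothesis FD : forall i, {morph F i : u v / u + v}.

(** The common form of the four products, as functions of their first argument. *)
Definition extension u := \sum_(i \in [set: I]) F i (component W u i).

Lemma hom_part0 i : F i 0 = 0.
Proof. by apply: (addrI (F i 0)); rewrite -FD !addr0. Qed.

Lemma extensionD : {morph extension : u v / u + v}.
Proof.
move=> u v; rewrite /extension componentD.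
have [s [us hs _ _]] := decompositionP (componentP u).
have [t [ut ht _ _]] := decompositionP (componentP v).
have uu := undup_uniq (s ++ t).
rewrite !(fsum_seq uu) -?big_split.
- by apply: eq_bigr => i _; rewrite FD.
- by move=> i; rewrite mem_undup mem_cat negb_or => /andP[_ /ht ->]; rewrite hom_part0.
- by move=> i; rewrite mem_undup mem_cat negb_or => /andP[/hs -> _]; rewrite hom_part0.
- by move=> i; rewrite mem_undup mem_cat negb_or /= => /andP[/hs hi /ht hj];
      rewrite hi hj addr0 hom_part0.
Qed.

Lemma extension_hom i u : W i u -> extension u = F i u.
Proof.
move=> hu; rewrite /extension (component_hom hu) (@fsum_seq _ _ [:: i]) //.
  by rewrite big_seq1 eqxx.
by move=> j; rewrite inE => /negbTE ->; rewrite hom_part0.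
Qed.

End DirectSums.

(** * Residues *)

Section Residues.
Variables (R : realType) (V : lmodType R[i]) (VA : vertex_algebra V).
Local Notation C := R[i].
Local Notation md := (mode VA).

Lemma mode_truncation_nat (u v : V) : exists K : nat, forall n : int, K%:Z <= n ->
  md u n v = 0.
Proof.
have [N hN] := mode_truncation VA u v; exists `|N|%N => n h; apply: hN; lia.
Qed.

Lemma mode_truncation_fin (A B : nat) (U X : nat -> V) :
  exists K : nat, forall a b (n : int), (a < A)%N -> (b < B)%N -> K%:Z <= n ->
    md (U a) n (X b) = 0.
Proof.
elim: A => [|A [K IH]]; first by exists 0%N.
have [K' IH'] : exists K' : nat, forall b (n : int), (b < B)%N -> K'%:Z <= n ->
    md (U A) n (X b) = 0.
  elim: B {IH} => [|B [K' IH]]; first by exists 0%N.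
  have [K'' h] := mode_truncation_nat (U A) (X B); exists (K' + K'')%N => b n.
  rewrite ltnS leq_eqVlt => /orP[/eqP ->|bB] hn; first by apply: h; lia.
  by apply: IH => //; lia.
exists (K + K')%N => a b n.
rewrite ltnS leq_eqVlt => /orP[/eqP ->|aA] bB hn; first by apply: IH' => //; lia.
by apply: IH => //; lia.
Qed.

(** Only finitely many terms of the residue are nonzero, since both the Laurent
    series and the modes u_j v are truncated. *)
Lemma residueE (N : nat) (p : nat -> C) (u v : V) (K : nat) :
  (forall k, (K <= k)%N -> md u (k%:Z - N%:Z) v = 0) ->
  residue VA (laurent N p) u v = \sum_(k < K) p k *: md u (k%:Z - N%:Z) v.
Proof.
move=> h; rewrite /residue (@fsum_seq _ _ [seq k%:Z - N%:Z | k <- iota 0 K]).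
- rewrite big_map -{1}[K]subn0 -/(index_iota 0 K) big_mkord; apply: eq_bigr => k _.
  by rewrite /laurent subrK.
- by rewrite map_inj_uniq ?iota_uniq // => i j; lia.
- move=> j hj; rewrite /laurent; case e: (j + N%:Z) => [k|k]; last by rewrite scale0r.
  have ej : j = k%:Z - N%:Z by lia.
  rewrite ej h ?scaler0 // leqNgt; apply: contra hj => kK.
  by apply/mapP; exists k; rewrite ?mem_iota.
Qed.

Lemma residue_linearl N p v : linear (fun u => residue VA (laurent N p) u v : V).
Proof.
move=> a u u'; have [K h] := mode_truncation_nat u v; have [K' h'] :=
    mode_truncation_nat u' v.
rewrite !(@residueE _ _ _ _ (K + K' + N)).
- rewrite scaler_sumr -big_split; apply: eq_bigr => k _ /=.
  by rewrite modeDl modeZl scalerDr !scalerA mulrC.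
- by move=> k hk; apply: h'; lia.
- by move=> k hk; apply: h; lia.
- by move=> k hk; rewrite modeDl modeZl h ?h' ?scaler0 ?addr0 //; lia.
Qed.

Lemma residue_add N p v : {morph (residue VA (laurent N p))^~ v : u u' / u + u'}.
Proof.
by move=> u u'; have := residue_linearl N p v 1 u u'; rewrite !scale1r.
Qed.

Lemma residue_linearr N p u : linear (residue VA (laurent N p) u).
Proof.
move=> a v v'; have [K h] := mode_truncation_nat u v; have [K' h'] :=
    mode_truncation_nat u v'.
rewrite !(@residueE _ _ _ _ (K + K' + N)).
- rewrite scaler_sumr -big_split; apply: eq_bigr => k _ /=.
  by rewrite linearP scalerDr !scalerA mulrC.
- by move=> k hk; apply: h'; lia.
- by move=> k hk; apply: h; lia.
- by move=> k hk; rewrite linearP /= h ?h' ?scaler0 ?addr0 //; lia.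
Qed.

HB.instance Definition _ N p u :=
  GRing.isLinear.Build C V V *:%R (residue VA (laurent N p) u) (@residue_linearr N p u).

Lemma exp_laurentE (a : C) N : exp_laurent a N =
  laurent N (exp_series a * (expm1_ratio C)^-1 ^+ N).
Proof.
rewrite /exp_laurent; congr laurent.
by rewrite -inv_ps_inv ?expm1_ratio0 // -ps_expE.
Qed.

End Residues.

(** * Eigenspaces of an operator of finite order *)

Section RootsOfUnity.
Variables (R : realType) (T : nat).
Hypothesis T0 : (0 < T)%N.
Local Notation C := R[i].
Local Notation z := (@Defs.root_of_unity R T).

Lemma root_of_unityD (a b : nat) : z (a + b)%N = z a * z b.
Proof.
rewrite /Defs.root_of_unity; set t := fun r : nat => - (2 * pi * r%:R / T%:R) : R.
have -> : - (2 * pi * (a + b)%N%:R / T%:R) = t a + t b by rewrite /t natrD; ring.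
rewrite -/(t a) -/(t b) cosD sinD; apply/eqP; rewrite eq_complex /=.
by rewrite eqxx /= addrC [X in _ + X]mulrC mulrC addrC.
Qed.

Lemma root_of_unity0 : z 0 = 1.
Proof. by rewrite /Defs.root_of_unity mulr0 mul0r oppr0 cos0 sin0. Qed.

Lemma root_of_unityX k r : z (k * r)%N = z r ^+ k.
Proof. by elim: k => [|k IH]; rewrite ?root_of_unity0 // mulSn root_of_unityD IH exprS.
    Qed.

Lemma root_of_unityT : z T = 1.
Proof.
rewrite /Defs.root_of_unity mulfK ?pnatr_eq0 -?lt0n // mulrC mulr_natr.
by rewrite cosN sinN cos2pi sin2pi oppr0.
Qed.

(** If y = pi k / T, then 0 < y < pi and cos (2 y) = 1 - 2 (sin y)^2 < 1. *)
Lemma root_of_unity_neq1 k : (0 < k < T)%N -> z k != 1.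
Proof.
move=> /andP[k0 kT]; rewrite /Defs.root_of_unity; set y : R := pi * k%:R / T%:R.
have -> : - (2 * pi * k%:R / T%:R) = - (y *+ 2) :> R.
  by rewrite /y; ring.
rewrite eq_complex /= negb_and cosN cos_mulr2n; apply/orP; left.
have T0' : 0 < T%:R :> R by rewrite ltr0n.
have : 0 < y < pi.
  rewrite /y !mulr_gt0 ?pi_gt0 ?ltr0n ?invr_gt0 //=.
  by rewrite -mulrA gtr_pMr ?pi_gt0 // ltr_pdivrMr // mul1r ltr_nat.
move=> /sin_gt0_pi s0; apply: contraTN s0 => /eqP h.
have : sin y ^+ 2 = 0.
  have : (1 - cos y ^+ 2) * 2 = 0.
    transitivity (1 - (cos y ^+ 2 *+ 2 - 1)); first by ring.
    by rewrite h subrr.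
  by move/eqP; rewrite mulf_eq0 pnatr_eq0 orbF sin2cos2 => /eqP.
by move=> /eqP; rewrite sqrf_eq0 => /eqP ->; rewrite ltxx.
Qed.

Lemma root_of_unity_neq0 k : z k != 0.
Proof.
apply/eqP => h; have := root_of_unityX T k.
rewrite mulnC root_of_unityX root_of_unityT expr1n h expr0n gtn_eqF // => /eqP.
by rewrite oner_eq0.
Qed.

Lemma root_of_unity_power r : z r ^+ T = 1.
Proof. by rewrite -root_of_unityX mulnC root_of_unityX root_of_unityT expr1n. Qed.

Lemma root_of_unity_inj (r s : 'I_T) : r != s -> z s / z r != 1.
Proof.
wlog : r s / (r < s)%N => [h rs|rs _].
  move: (rs); rewrite -val_eqE neq_ltn => /orP[|] lt; first exact: h.
  have := h _ _ lt; rewrite eq_sym rs => /(_ isT); apply: contra => /eqP e.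
  by rewrite -[z r / z s]invrK invf_div e invr1.
have -> : (s : nat) = ((s - r) + r)%N by rewrite subnK // ltnW.
rewrite root_of_unityD mulfK ?root_of_unity_neq0 //; apply: root_of_unity_neq1.
by have := ltn_ord s; lia.
Qed.

Lemma geometric_sum0 (x : C) : x ^+ T = 1 -> x != 1 -> \sum_(k < T) x ^+ k = 0.
Proof.
move=> xT x1; have := subrX1 x T; rewrite xT subrr => /esym/eqP.
by rewrite mulf_eq0 subr_eq0 (negbTE x1) /= => /eqP.
Qed.

Variables (V : lmodType C) (g : {linear V -> V}).
Hypothesis gT : iter T g =1 id.

(** The projection onto the eigenspace V^r of g. *)
Definition sector_proj (r : nat) (v : V) : V :=
  T%:R^-1 *: \sum_(k < T) (z r)^-1 ^+ k *: iter k g v.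

Lemma iter_linear k : linear (iter k g).
Proof. by elim: k => [//|k IH] a u v; rewrite iterS IH linearP. Qed.

Lemma sector_proj_linear r : linear (sector_proj r).
Proof.
move=> a u v; rewrite /sector_proj scalerA mulrC -scalerA -scalerDr; congr (_ *: _).
rewrite scaler_sumr -big_split; apply: eq_bigr => k _ /=.
by rewrite iter_linear scalerDr !scalerA mulrC.
Qed.

HB.instance Definition _ r := GRing.isLinear.Build C V V *:%R (sector_proj r)
  (@sector_proj_linear r).

Lemma order_neq0 : T%:R != 0 :> C. Proof. by rewrite pnatr_eq0 -lt0n. Qed.

Lemma sector_proj_in (r : 'I_T) v : gspace g r (sector_proj r v).
Proof.
rewrite /gspace /= /sector_proj linearZ /= scalerA mulrC -scalerA; congr (_ *: _).
rewrite linear_sum scaler_sumr /=.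
pose F k : V := (z r * (z r)^-1 ^+ k) *: iter k g v.
transitivity (\sum_(k < T) F k.+1).
  apply: eq_bigr => k _; rewrite linearZ /= /F exprS mulrA divff ?root_of_unity_neq0 //.
  by rewrite mul1r.
transitivity (\sum_(k < T) F k); last by apply: eq_bigr => k _; rewrite scalerA.
apply: (addrI (F 0%N)); rewrite -(big_ord_recl T (fun k : 'I_T.+1 => F k)) big_ord_recr
    /= addrC.
by rewrite /F gT exprVn root_of_unity_power invr1 expr0.
Qed.

Lemma sector_proj_hom (r s : 'I_T) v : gspace g s v -> sector_proj r v =
  if r == s then v else 0.
Proof.
move=> hv; have it k : iter k g v = z s ^+ k *: v.
  by elim: k => [|k IH]; rewrite ?expr0 ?scale1r // iterS IH linearZ /= hv scalerA
      exprSr.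
rewrite /sector_proj; under eq_bigr => k _ do rewrite it scalerA -exprMn mulrC.
rewrite -scaler_suml; case: eqVneq => [->|rs].
  under eq_bigr do rewrite divff ?root_of_unity_neq0 // expr1n.
  by rewrite sumr_const card_ord scalerA mulVf ?order_neq0 // scale1r.
rewrite geometric_sum0 ?scale0r ?scaler0 ?root_of_unity_inj //.
by rewrite exprMn exprVn !root_of_unity_power divr1.
Qed.

Lemma sector_proj_sum v : \sum_(r < T) sector_proj r v = v.
Proof.
rewrite /sector_proj -scaler_sumr exchange_big /=.
transitivity (T%:R^-1 *: (T%:R *: v));
    last by rewrite scalerA mulVf ?order_neq0 // scale1r.
congr (_ *: _).
rewrite (bigD1 (Ordinal T0)) //= [X in _ + X]big1 ?addr0 => [|k k0].
  by under eq_bigr do rewrite expr0 scale1r; rewrite sumr_const card_ord scaler_nat.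
rewrite -scaler_suml (eq_bigr (fun r : 'I_T => ((z k)^-1) ^+ r)); last first.
  by move=> r _; rewrite !exprVn -!root_of_unityX mulnC.
have zk : z k != 1.
  by apply: root_of_unity_neq1; rewrite ltn_ord lt0n -val_eqE in k0 *; rewrite k0.
rewrite geometric_sum0 ?scale0r ?invr_eq1 //.
by rewrite exprVn root_of_unity_power invr1.
Qed.

Lemma gspace_direct_sum : is_direct_sum (gspace g (T := T)).
Proof.
move=> v; exists (fun r : 'I_T => sector_proj r v); split.
  apply: (@decomposition_seq _ _ _ _ _ _ (enum 'I_T)); first exact: enum_uniq.
  - by move=> i; rewrite mem_enum.
  - by move=> r; exact: sector_proj_in.
  - by rewrite big_enum /= sector_proj_sum.
move=> x [_ hx ->]; apply/funext => r.
rewrite (@fsum_seq _ _ (enum 'I_T)) ?enum_uniq // => [|i]; last by rewrite mem_enum.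
rewrite big_enum /= linear_sum (bigD1 r) //= (sector_proj_hom _ (hx r)) eqxx.
rewrite big1 ?addr0 // => s sr; rewrite (sector_proj_hom _ (hx s)).
by rewrite eq_sym (negbTE sr).
Qed.

Section Bigraded.
Variables (I : choiceType) (W : I -> set V).
Hypothesis Wds : is_direct_sum W.
Hypothesis W0 : forall i, W i 0.
Hypothesis WD : forall i u v, W i u -> W i v -> W i (u + v).
Hypothesis WZ : forall i a u, W i u -> W i (a *: u).
Hypothesis Wg : forall i u, W i u -> W i (g u).

Lemma sector_proj_stable i r u : W i u -> W i (sector_proj r u).
Proof.
move=> hu; apply: WZ; elim/big_ind: _ => [||k _]; [exact: W0 | exact: WD |].
by apply: WZ; elim: (k : nat) => //= k' IH; apply: Wg.
Qed.

(** The component of v in the intersection of V^r and W_i is the projection to V^r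
    of its component in W_i, because the projection preserves W_i. *)
Lemma bigraded_direct_sum :
  is_direct_sum (fun p : 'I_T * I => (gspace g p.1 `&` W p.2)%classic).
Proof.
move=> v; pose y := component W v.
have [s [us hs yW ev]] := decompositionP (componentP Wds v).
have pairs_uniq (t : seq I) : uniq t -> uniq [seq (r, c) | r <- enum 'I_T, c <- t].
  by move=> ut; apply: allpairs_uniq; rewrite ?enum_uniq // => -[? ?] [? ?].
have pairs_out (t : seq I) p : p \notin [seq (r, c) | r <- enum 'I_T, c <- t] ->
    p.2 \notin t.
  by case: p => r c; apply: contra => ct; apply: allpairs_f; rewrite ?mem_enum.
exists (fun p : 'I_T * I => sector_proj p.1 (y p.2)); split.
  apply: (decomposition_seq (pairs_uniq _ us)).
  - by move=> p /pairs_out/hs; rewrite -/y => ->; rewrite linear0.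
  - by move=> p; split; [exact: sector_proj_in | exact/sector_proj_stable/yW].
  - rewrite big_allpairs_dep big_enum /= {1}ev exchange_big /=; apply: eq_bigr => c _.
    by rewrite sector_proj_sum.
move=> x /decompositionP [t [ut ht xW ex]]; apply/funext => -[r c] /=.
pose t' := undup (map snd t).
have ht' p : p.2 \notin t' -> x p = 0.
  by rewrite mem_undup => h; apply: ht; apply: contra h; apply: map_f.
have -> : y = fun c => \sum_(r < T) x (r, c).
  apply: componentE => //; apply: (@decomposition_seq _ _ _ _ _ _ t').
  - exact: undup_uniq.
  - by move=> i hi; rewrite big1 // => q _; apply: ht'.
  - move=> i; elim/big_ind: _ => [||q _]; [exact: W0 | exact: WD |].
    by have [] := xW (q, i).
  - rewrite exchange_big {1}ex -(fsum_seq ut ht) /=.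
    rewrite (fsum_seq (pairs_uniq t' (undup_uniq _))) => [|p /pairs_out/ht' //].
    by rewrite big_allpairs_dep big_enum.
rewrite linear_sum (bigD1 r) //= (@sector_proj_hom _ r); last by have [] := xW (r, c).
rewrite eqxx big1 ?addr0 // => q qr; rewrite (@sector_proj_hom _ q); last by have [] :=
    xW (q, c).
by rewrite eq_sym (negbTE qr).
Qed.
End Bigraded.

End RootsOfUnity.

(** * Isomorphisms between quotients *)

Section QuotientIsomorphism.
Variables (K : fieldType) (V : lmodType K).

Lemma lspan_gen (S : set V) x : S x -> lspan S x.
Proof. by move=> Sx M [_]; apply. Qed.

Lemma lspan_image (S S' : set V) (f : V -> V) : linear f ->
  (forall x, S x -> lspan S' (f x)) -> forall x, lspan S x -> lspan S' (f x).
Proof.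
move=> lf h x hx; apply: (hx [set y | lspan S' (f y)]%classic); split=> //=;
    split=> /= [|a u v].
  have -> : f 0 = 0 by have := lf (-1) 0 0; rewrite scaler0 addr0 scaleN1r addNr.
  exact: (lspan_closed S').1.
by move=> hu hv; rewrite lf; apply: (lspan_closed S').2.
Qed.

(** The induced product of two classes is the only element of a set of
    candidates, or 0 if this set is empty.  The isomorphism carries the set for a
    pair of classes onto the set for their images and therefore
    preserves the product. *)
Lemma quotient_algebra_iso (O O' : set V) (mul mul' : V -> V -> V) (one one' : V)
    (f : {linear V -> V}) : bijective f ->
  (forall x, O x -> lspan O' (f x)) ->
  (forall y, O' y -> exists2 x, lspan O x & f x = y) ->
  f one = one' -> (forall u v, f (mul u v) = mul' (f u) (f v)) ->
  algebra_isomorphic (quotient_algebra O mul one) (quotient_algebra O' mul' one').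
Proof.
move=> [h fK hK] fO hO f1 fM.
have lh : linear h.
  by move=> a u v; apply: (can_inj fK); rewrite linearP !hK.
have spanE x : lspan O x <-> lspan O' (f x).
  split; first by apply: lspan_image => //; exact: linearP.
  move=> hx; rewrite -[x]fK; apply: (lspan_image lh) hx => y /hO [u hu <-].
  by rewrite fK.
pose q := @quotient_map K V O; pose q' := @quotient_map K V O'.
pose F (a : quotient_space O) : quotient_space O' := q' (f (repr a)).
have Fq v : F (q v) = q' (f v).
  apply/quotient_map_eq; rewrite -linearB; apply/spanE/quotient_map_eq.
  exact: reprK.
have lF : linear F.
  move=> c a b; have [u <-] := quotient_map_surj a; have [v <-] := quotient_map_surj b.
  rewrite -[c *: _]/(quotient_scale c _) -quotient_mapZ -quotient_mapD !Fq linearP.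
  by rewrite [LHS]quotient_mapD [X in X + _]quotient_mapZ.
have qE u v : F (q u) = F (q v) -> q u = q v.
  rewrite !Fq => /quotient_map_eq; rewrite -linearB => /spanE ?.
  exact/quotient_map_eq.
have Finj : injective F.
  move=> a b; have [u <-] := quotient_map_surj a; have [v <-] := quotient_map_surj b.
  exact: qE.
pose H (b : quotient_space O') : quotient_space O := q (h (repr b)).
have HK : cancel H F.
  by move=> b; rewrite /H Fq hK; exact: reprK.
have FK : cancel F H by move=> a; apply: Finj; rewrite HK.
pose FL : {linear quotient_space O -> quotient_space O'} :=
  HB.pack F (GRing.isLinear.Build K _ _ *:%R F lF).
exists FL; split; first by exists H.
  by rewrite /= Fq f1.
move=> a b; rewrite /alg_mul /= /induced_mul.
set S := (X in F (xget 0 X)); set S' := (X in _ = xget 0 X).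
have SS' c : S c -> S' (F c).
  move=> Sc u' v' eu ev; transitivity (F (q (mul (h u') (h v')))).
    by rewrite Fq fM !hK.
  congr F; apply: Sc.
    by apply: Finj; rewrite Fq hK.
  by apply: Finj; rewrite Fq hK.
have S'S c : S' (F c) -> S c.
  move=> Sc u v eu ev; apply: Finj; rewrite Fq fM; apply: Sc.
    by rewrite -[LHS]Fq /q eu.
  by rewrite -[LHS]Fq /q ev.
have S'uniq c d : S' c -> S' d -> c = d.
  have [u eu] := quotient_map_surj (F a); have [v ev] := quotient_map_surj (F b).
  by move=> hc hd; rewrite -(hc u v eu ev) (hd u v eu ev).
have [[c Sc]|nS] := pselect (exists c, S c).
  apply: S'uniq; first by apply: SS'; apply: (xgetPex 0); exists c.
  by apply: (xgetPex 0); exists (F c); exact: SS'.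
rewrite !xgetPN; first exact: (linear0 FL).
- by move=> d Sd; apply: nS; exists (H d); apply: S'S; rewrite HK.
- by move=> d Sd; apply: nS; exists d.
Qed.

End QuotientIsomorphism.

(** * The change of coordinate on a vertex operator algebra *)

Section CoordinateChange.
Variables (R : realType) (V : lmodType R[i]) (VA : vertex_algebra V).
Local Notation C := R[i].
Local Notation md := (mode VA).
Variable omega : V.
Hypothesis hV : vertex_operator_algebra VA omega.
Local Notation L := (Lop VA omega).
Local Notation wt := (weight_space VA omega).
Local Notation coord_coef := (coord_coef VA omega).

Let conf := voa_conformal hV.
Let L0ds := conformal_L0 conf.

Lemma weight_space0 c : wt c 0.
Proof. by rewrite /weight_space /= linear0 scaler0. Qed.
Lemma weight_spaceD c u v : wt c u -> wt c v -> wt c (u + v).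
Proof. by move=> hu hv; rewrite /weight_space /= linearD /= hu hv scalerDr. Qed.

(** The subspace of sums of vectors of weights N0, ..., N0 + d - 1; with N0 a lower
    bound of the weights, these subspaces exhaust V. *)
Definition low (N0 : int) (d : nat) (v : V) : Prop :=
  exists x : nat -> V, (forall i, wt (N0 + i%:Z)%:~R (x i)) /\ v = \sum_(i < d) x i.

Lemma low0 N0 v : low N0 0 v -> v = 0.
Proof. by move=> [x [_ ->]]; rewrite big_ord0. Qed.

Lemma lowD N0 d u v : low N0 d u -> low N0 d v -> low N0 d (u + v).
Proof.
move=> [x [hx ->]] [y [hy ->]]; exists (x \+ y); split=> [i|];
    last by rewrite big_split.
by apply: weight_spaceD.
Qed.

Lemma low_zero N0 d : low N0 d 0.
Proof. by exists (fun=> 0); split=> [i|]; [exact: weight_space0 | rewrite big1]. Qed.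

Lemma low_sum N0 d I (s : seq I) (P : pred I) (F : I -> V) :
  (forall i, P i -> low N0 d (F i)) -> low N0 d (\sum_(i <- s | P i) F i).
Proof. by move=> h; apply: big_ind => //; [exact: low_zero | exact: lowD]. Qed.

Lemma low_widen N0 d e v : (d <= e)%N -> low N0 d v -> low N0 e v.
Proof.
move=> de [x [hx ->]]; exists (fun i => if (i < d)%N then x i else 0); split=> [i|].
  by case: ifP => // _; exact: weight_space0.
rewrite (@sum_ord_widen _ (fun i => if (i < d)%N then x i else 0) d) //.
  by apply: eq_bigr => i _; rewrite ltn_ord.
by move=> i; rewrite ltnNge => ->.
Qed.

Variable N0 : int.
Hypothesis N0P : forall m : int, m < N0 -> forall v, wt m%:~R v -> v = 0.

Lemma low_hom (z : int) d u : wt z%:~R u -> z < N0 + d%:Z -> low N0 d u.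
Proof.
move=> hu hz; have [zN|Nz] := ltP z N0.
  by rewrite (N0P zN hu); exact: low_zero.
have [i ei] : exists i : nat, z = N0 + i%:Z by exists `|z - N0|%N; lia.
have id : (i < d)%N by lia.
exists (fun j => if j == i then u else 0); split=> [j|].
  by case: eqP => [->|_]; [rewrite -ei | exact: weight_space0].
by rewrite (bigD1 (Ordinal id)) //= eqxx big1 ?addr0 // => j;
    rewrite -val_eqE /= => /negbTE ->.
Qed.

Lemma low_exists v : exists d, low N0 d v.
Proof.
apply: (direct_sum_ind L0ds (P := fun v => exists d, low N0 d v)) =>
    [|u u' [d hd] [e he]|c u hu].
- by exists 0%N; exact: low_zero.
- by exists (d + e)%N; apply: lowD; [apply: low_widen hd|apply: low_widen he]; lia.
- have [->|u0] := eqVneq u 0; first by exists 0%N; exact: low_zero.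
  have [m em] := voa_integer hV hu u0; rewrite em in hu.
  exists (`|m - N0|.+1)%N; apply: (low_hom hu); lia.
Qed.

Lemma low_coord_coef d k v : low N0 d v -> low N0 (d - k) (coord_coef k v).
Proof.
move=> [x [hx ->]]; rewrite linear_sum; apply: low_sum => -[i /= id] _.
have := coord_coef_weight conf k (hx i).
have -> : (N0 + i%:Z)%:~R - k%:R =
    (N0 + i%:Z - k%:Z)%:~R :> C by rewrite [RHS]rmorphB /= -pmulrn.
by move/low_hom; apply; lia.
Qed.

Lemma coord_coef_finite v : exists K, forall k, (K <= k)%N -> coord_coef k v = 0.
Proof.
have [d hd] := low_exists v; exists d => k dk.
by apply: (@low0 N0); have := low_coord_coef k hd; rewrite (eqP (_ : d - k == 0)%N).
Qed.

(** The map Phi.  The sum is finite at every vector because Phi_k lowers weights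
    by k. *)
Definition coord_change (v : V) : V := \sum_(k \in [set: nat]) coord_coef k v.

Lemma coord_changeE v K : (forall k, (K <= k)%N -> coord_coef k v = 0) ->
  coord_change v = \sum_(k < K) coord_coef k v.
Proof. exact: fsum_nat. Qed.

Lemma coord_change_linear : linear coord_change.
Proof.
move=> a u v; have [K h] := coord_coef_finite u; have [K' h'] := coord_coef_finite v.
rewrite !(@coord_changeE _ (K + K')%N).
- rewrite scaler_sumr -big_split; apply: eq_bigr => k _ /=; exact: linearP.
- by move=> k hk; apply: h'; lia.
- by move=> k hk; apply: h; lia.
- by move=> k hk; rewrite linearP /= h ?h' ?scaler0 ?addr0 //; lia.
Qed.

HB.instance Definition _ := GRing.isLinear.Build C V V *:%R coord_change
  coord_change_linear.

Lemma low_coord_change d v : low N0 d v -> low N0 d.-1 (coord_change v - v).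
Proof.
move=> hv; have [K h] := coord_coef_finite v.
rewrite (@coord_changeE _ K.+1); last by move=> k hk; apply: h; lia.
rewrite big_ord_recl addrAC subrr add0r; apply: low_sum => k _.
by apply: low_widen (low_coord_coef k.+1 hv); lia.
Qed.

(** Phi - id decreases the filtration, so that both the triviality of the kernel
    and the surjectivity follow by induction on it. *)
Lemma coord_change_bij : bijective coord_change.
Proof.
have inj : injective coord_change.
  have ker v : coord_change v = 0 -> v = 0.
    move=> h; have [d] := low_exists v; elim: d => [|d IH]; first exact: low0.
    move=> hd; apply: IH; have := low_coord_change hd; rewrite h sub0r => -[x [hx e]].
    exists (fun i => - x i); split=> [i|]; last by rewrite sumrN -e opprK.
    by rewrite /weight_space /= linearN /= hx scalerN.
  by move=> u v h; apply/eqP; rewrite -subr_eq0; apply/eqP/ker;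
      rewrite linearB /= h subrr.
have surj v : exists u, coord_change u = v.
  have [d] := low_exists v; elim: d v => [|d IH] v.
    by move/low0 => ->; exists 0; rewrite linear0.
  move/low_coord_change/IH => [u hu]; exists (v - u).
  by rewrite linearB /= hu opprB addrC subrK.
pose h v := projT1 (cid (surj v)).
by exists h => v; [apply: inj|]; rewrite /h; case: cid.
Qed.

Lemma coord_change_vac : coord_change (vac VA) = vac VA.
Proof.
rewrite (@coord_changeE _ 1) ?big_ord1 // => -[|k] // _.
by rewrite coord_coef_vac.
Qed.

(** The intertwining property at s = 1.  The bounds A, B and K only need to be
    large enough, so that the same K can serve for all modes in a residue. *)
Lemma coord_change_mode (w : C) (m : int) (u v : V) (A B K : nat) : wt w u ->
  (forall k, (A <= k)%N -> coord_coef k u = 0) ->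
      (forall k, (B <= k)%N -> coord_coef k v = 0) ->
  (forall a b c, (K <= c)%N -> md (coord_coef a u) (m + c%:Z) (coord_coef b v) = 0) ->
  coord_change (md u m v) = \sum_(a < A) \sum_(b < B) \sum_(c < K)
    mode_change (w - a%:R) m c *: md (coord_coef a u) (m + c%:Z) (coord_coef b v).
Proof.
move=> hu hA hB hK; have [N hN] := coord_coef_finite (md u m v).
pose M := (A + B + K + N)%N.
rewrite (@coord_changeE _ M); last by move=> k hk; apply: hN; rewrite /M in hk; lia.
pose G (a b : nat) := \sum_(k < M) bracket_mode VA (w - a%:R) m (k%:Z - a%:Z - b%:Z)
    (coord_coef a u) (coord_coef b v).
transitivity (\sum_(a < M) \sum_(b < M) G a b).
  rewrite /G; under [RHS]eq_bigr do rewrite exchange_big /=.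
  rewrite [RHS]exchange_big /=; apply: eq_bigr => k _.
  exact: (coord_coef_mode conf _ _ hu).
have b0r w' c x : bracket_mode VA w' m c x 0 = 0 by rewrite linear0.
have b0l w' c x : bracket_mode VA w' m c 0 x = 0 by case: c => c //=;
    rewrite mode0l scaler0.
rewrite (@sum_ord_widen _ (fun a => \sum_(b < M) G a b) A); last 2 first.
- by rewrite /M; lia.
- by move=> a /hA ha; rewrite big1 // => b _; rewrite /G big1 // => k _; rewrite ha.
apply: eq_bigr => -[a /= aA] _.
rewrite (@sum_ord_widen _ (G a) B); last 2 first.
- by rewrite /M; lia.
- by move=> b /hB hb; rewrite /G big1 // => k _; rewrite hb.
apply: eq_bigr => -[b /= bB] _.
rewrite /G -(big_mkord xpredT (fun k => bracket_mode VA (w - a%:R) m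
    (k%:Z - a%:Z - b%:Z) (coord_coef a u) (coord_coef b v))).
rewrite (big_cat_nat (n := (a + b)%N)) //=; last by rewrite /M; lia.
rewrite [X in X + _]big_nat_cond [X in X + _]big1 ?add0r; last first.
  move=> k /andP[/andP[_ kab] _].
  have : k%:Z - a%:Z - b%:Z < 0 by lia.
  by case: (k%:Z - a%:Z - b%:Z).
rewrite -[X in \sum_(X <= _ < _) _]add0n big_addn big_mkord.
rewrite -(@sum_ord_widen _ (fun c => mode_change (w - a%:R) m c *:
   md (coord_coef a u) (m + c%:Z) (coord_coef b v)) K (M - (a + b))); last 2 first.
- by rewrite /M; lia.
- by move=> c hc; rewrite hK // scaler0.
apply: eq_bigr => c _.
by have -> : (c + (a + b))%N%:Z - a%:Z - b%:Z = c by lia.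
Qed.

(** The intertwining property followed by the substitution x = log(1 + z). *)
Lemma coord_change_residue (w a : C) (N A : nat) (u v : V) : wt w u ->
  (forall k, (A <= k)%N -> coord_coef k u = 0) ->
  coord_change (residue VA (exp_laurent a N) u v) =
  \sum_(i < A) residue VA (binomial_laurent (w - i%:R - 1 + a) N) (coord_coef i u)
      (coord_change v).
Proof.
move=> hu hA; have [B hB] := coord_coef_finite v.
have [K1 h1] := mode_truncation_nat VA u v.
have [K2 h2] := mode_truncation_fin VA A B (coord_coef^~ u) (coord_coef^~ v).
pose K := (K1 + K2 + N)%N.
have hK i b (c : int) : K2%:Z <= c -> md (coord_coef i u) c (coord_coef b v) = 0.
  have [Ai|iA] := leqP A i; first by rewrite hA ?mode0l.
  have [Bb|bB] := leqP B b; first by rewrite (hB b) ?linear0.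
  exact: h2.
rewrite exp_laurentE (@residueE _ _ _ _ _ _ _ K); last first.
  by move=> k hk; apply: h1; rewrite /K in hk; lia.
set p := (_ * _ : series C).
transitivity (\sum_(k < K) p k *: \sum_(i < A) \sum_(b < B) \sum_(c < K)
    mode_change (w - i%:R) (k%:Z - N%:Z) c *:
    md (coord_coef i u) (k%:Z - N%:Z + c%:Z) (coord_coef b v)).
  rewrite linear_sum; apply: eq_bigr => k _; rewrite linearZ /=; congr (_ *: _).
  apply: coord_change_mode => // i b c hc; apply: hK; rewrite /K in hc; lia.
under eq_bigr do rewrite scaler_sumr; rewrite exchange_big; apply: eq_bigr => i _ /=.
rewrite (coord_changeE hB) linear_sum /=.
under eq_bigr do rewrite scaler_sumr; rewrite exchange_big; apply: eq_bigr => b _ /=.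
rewrite (@residueE _ _ _ _ _ _ _ K); last first.
  by move=> k hk; apply: hK; rewrite /K in hk; lia.
pose G (c k : nat) := p k *: (mode_change (w - i%:R) (k%:Z - N%:Z) c *:
    md (coord_coef i u) (k%:Z - N%:Z + c%:Z) (coord_coef b v)).
transitivity (\sum_(c < K) \sum_(k < K) G c k).
  by rewrite exchange_big; apply: eq_bigr => k _; rewrite scaler_sumr.
rewrite sum_antidiagonal; last first.
  by move=> c k hck; rewrite /G hK ?scaler0 //; rewrite /K in hck; lia.
apply: eq_bigr => n _; rewrite -[gbinom _ n]/(binom_series _ n)
    -(exp_substitution _ _ N) scaler_suml.
apply: eq_bigr => -[k /= kn] _; rewrite /G scalerA; congr (_ *: md _ _ _); lia.
Qed.

(** Since D u = u_(-2) 1 and Phi fixes the vacuum, Phi (D u) is the mode of index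
    -2 of Y[Phi u, x] applied to the vacuum, in which only two terms survive. *)
Lemma coord_change_calD u : coord_change (calD VA u) =
  L (-1) (coord_change u) + L 0 (coord_change u).
Proof.
elim/(direct_sum_ind L0ds): u => [|u v hu hv|w u hu].
- by rewrite /calD mode0l !linear0 addr0.
- by rewrite /calD modeDl !linearD /= -/(calD VA u) -/(calD VA v) hu hv addrACA.
have [A hA] := coord_coef_finite u.
have h1 k : (1 <= k)%N -> coord_coef k (vac VA) = 0 by case: k => // k _;
    rewrite coord_coef_vac.
rewrite /calD (coord_change_mode (K := 2) hu hA h1); last first.
  move=> a b c hc; rewrite coord_coef_vac; case: ifP => _; last by rewrite linear0.
  by rewrite mode_creation ?ifN //; lia.
rewrite (coord_changeE hA) !linear_sum -big_split; apply: eq_bigr => a _ /=.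
rewrite big_ord1 coord_coef0 big_ord_recl big_ord1 /= mode_change0 scale1r addr0.
rewrite (conformal_Lm1 conf) -/(calD VA _); congr (_ + _).
rewrite mode_change_m2_1 mode_creation //=.
by rewrite (coord_coef_weight conf a hu).
Qed.

Section TwistedProducts.
Variables (g : {linear V -> V}) (T : nat) (n : rat).
Hypothesis hg : automorphism VA omega g.
Hypothesis T0 : (0 < T)%N.
Hypothesis gT : iter T g =1 id.
Local Notation bigraded := (bigraded_space VA omega g (T := T)).

Lemma aut_Lop (j : int) v : g (L j v) = L j (g v).
Proof. by rewrite /Lop (aut_mode hg) (aut_conformal hg). Qed.

Lemma aut_coord_coef k v : g (coord_coef k v) = coord_coef k (g v).
Proof.
apply: (@coord_coef_uniq _ _ VA omega (fun k => g (coord_coef k v)) _ k.+1) => // {}k _.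
rewrite -linearZ /= coord_coef_rec linear_sum; apply: eq_bigr => j _ /=.
by rewrite linearZ /= aut_Lop.
Qed.

Lemma gspace0 (r : 'I_T) : gspace g r 0.
Proof. by rewrite /gspace /= linear0 scaler0. Qed.
Lemma gspaceD (r : 'I_T) u v : gspace g r u -> gspace g r v -> gspace g r (u + v).
Proof. by rewrite /gspace /= linearD scalerDr => -> ->. Qed.

Lemma bigraded_space_direct_sum : is_direct_sum bigraded.
Proof.
apply: (bigraded_direct_sum T0 gT L0ds).
- exact: weight_space0.
- exact: weight_spaceD.
- by move=> c a u hu; rewrite /weight_space /= linearZ /= hu !scalerA mulrC.
- by move=> c u hu; rewrite /weight_space /= -aut_Lop hu linearZ.
Qed.

Lemma bigraded0 p : bigraded p 0.
Proof. by split; [exact: gspace0 | exact: weight_space0]. Qed.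
Lemma bigradedD p u v : bigraded p u -> bigraded p v -> bigraded p (u + v).
Proof. by move=> [? ?] [? ?]; split; [exact: gspaceD | exact: weight_spaceD]. Qed.

Lemma coord_coef_bigraded r w k u : bigraded (r, w) u ->
  bigraded (r, w - k%:R) (coord_coef k u).
Proof.
move=> [/= hr hw]; split; last exact: coord_coef_weight.
by rewrite /gspace /= aut_coord_coef hr linearZ.
Qed.

(** Reduction of the compatibility of Phi with a pair of products to bihomogeneous
    first arguments.  The image under Phi of a vector in V^r of weight w has
    components in V^r of weights w - a, each of which enters the product E with its
    own weight. *)
Lemma coord_change_extension (D : 'I_T -> V -> V -> V) (E : 'I_T -> C -> V -> V -> V) :
  (forall r v, {morph (D r)^~ v : u u' / u + u'}) ->
  (forall r w v, {morph (E r w)^~ v : u u' / u + u'}) ->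
  (forall r w u v A, wt w u -> (forall k, (A <= k)%N -> coord_coef k u = 0) ->
     coord_change (D r u v) = \sum_(a < A) E r (w - a%:R) (coord_coef a u)
         (coord_change v)) ->
  forall u v,
  coord_change (\sum_(r < T) D r (component (gspace g (T := T)) u r) v) =
  \sum_(p \in [set: 'I_T * C]) E p.1 p.2 (component bigraded (coord_change u) p)
      (coord_change v).
Proof.
move=> DD ED DE u v.
pose dia u := extension (gspace g (T := T)) (fun r u => D r u v) u.
pose cir u := extension bigraded (fun p u => E p.1 p.2 u (coord_change v)) u.
have gds := gspace_direct_sum T0 gT; have bds := bigraded_space_direct_sum.
have diaD : {morph dia : u u' / u + u'}.
  exact: (extensionD gds gspaceD (fun r => DD r v)).
have cirD : {morph cir : u u' / u + u'}.
  exact: (extensionD bds bigradedD (fun p => ED p.1 p.2 (coord_change v))).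
have dia0 : dia 0 = 0 by apply: (addrI (dia 0)); rewrite -diaD !addr0.
have cir0 : cir 0 = 0 by apply: (addrI (cir 0)); rewrite -cirD !addr0.
suff : coord_change (dia u) = cir (coord_change u).
  rewrite /dia /extension (@fsum_seq _ _ (enum 'I_T)) ?enum_uniq //.
    by rewrite big_enum.
  by move=> r; rewrite mem_enum.
elim/(direct_sum_ind bds): u => [|u u' hu hu'|[r w] u hu].
- by rewrite dia0 !linear0 cir0.
- by rewrite diaD !linearD /= hu hu' cirD.
have [A hA] := coord_coef_finite u; have [hr hw] := hu.
rewrite /dia (extension_hom gds gspace0 (fun r => DD r v) hr) (DE _ _ _ _ _ hw hA).
rewrite (coord_changeE hA) (big_morph cir cirD cir0); apply: eq_bigr => a _.
by rewrite /cir (extension_hom bds bigraded0 (fun p => ED p.1 p.2 (coord_change v))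
    (coord_coef_bigraded a hu)).
Qed.

Lemma coord_change_diamond u v : coord_change (diamond VA g T n u v) =
  circ VA omega g T n (coord_change u) (coord_change v).
Proof.
apply: (coord_change_extension (D := diamond_hom VA n) (E := circ_hom VA n)).
- by move=> r v' u1 u2; exact: residue_add.
- by move=> r w v' u1 u2; exact: residue_add.
- by move=> r w u1 v1 A hw hA; exact: coord_change_residue.
Qed.

Lemma coord_change_bullet u v : coord_change (bullet VA g T n u v) =
  star VA omega g T n (coord_change u) (coord_change v).
Proof.
apply: (coord_change_extension (D := bullet_hom VA n) (E := star_hom VA n)).
- move=> r v' u1 u2; rewrite /bullet_hom; case: ifP => _; last by rewrite addr0.
  by rewrite -big_split; apply: eq_bigr => m _ /=; rewrite -scalerDr; congr (_ *: _);
      exact: residue_add.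
- move=> r w v' u1 u2; rewrite /star_hom; case: ifP => _; last by rewrite addr0.
  by rewrite -big_split; apply: eq_bigr => m _ /=; rewrite -scalerDr; congr (_ *: _);
      exact: residue_add.
move=> r w u1 v1 A hw hA; rewrite /bullet_hom /star_hom; case: ifP => _;
    last by rewrite linear0 big1.
rewrite linear_sum exchange_big; apply: eq_bigr => m _; rewrite linearZ /= -scaler_sumr.
congr (_ *: _); rewrite (coord_change_residue _ _ _ hw hA); apply: eq_bigr => a _.
have -> : w - a%:R - 1 + (Num.truncn n).+1%:R = w - a%:R + (Num.truncn n)%:R.
  by rewrite -natr1 [_ + 1]addrC addrA subrK.
by [].
Qed.

Lemma Atilde_iso : algebra_isomorphic (Atilde_algebra VA g T n)
  (A_algebra VA omega g T n).
Proof.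
have [h PhK hPK] := coord_change_bij.
apply: (quotient_algebra_iso (f := coord_change)); first exact: coord_change_bij.
- move=> x [[u [v ->]]|[u ->]]; apply: lspan_gen.
    by left; exists (coord_change u), (coord_change v); exact: coord_change_diamond.
  by right; exists (coord_change u); exact: coord_change_calD.
- move=> y [[u [v ->]]|[u ->]].
    exists (diamond VA g T n (h u) (h v)); last by rewrite /= coord_change_diamond !hPK.
    by apply: lspan_gen; left; exists (h u), (h v).
  exists (calD VA (h u)); last by rewrite /= coord_change_calD !hPK.
  by apply: lspan_gen; right; exists (h u).
- exact: coord_change_vac.
- exact: coord_change_bullet.
Qed.

End TwistedProducts.

End CoordinateChange.

Theorem theorem4p2 (R : realType) (V : lmodType R[i]) (VA : vertex_algebra V)
    (omega : V) (hV : vertex_operator_algebra VA omega)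
    (g : {linear V -> V}) (hg : automorphism VA omega g)
    (T : nat) (hT : has_order g T)
    (n : rat) (hn : exists k : nat, n = k%:R / T%:R) :
  algebra_isomorphic (Atilde_algebra VA g T n) (A_algebra VA omega g T n).
Proof.
have [T0 gT _] := hT; have [N0 N0P] := voa_bounded_below hV.
exact: (Atilde_iso hV N0P n hg T0 gT).
Qed.
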